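(* Let $G$ be a nonsingular finite simple graph of order $n\ge5$. Then $$\mathcal E(G)\ge n-1+\bar d(G),\qquad \mathcal E(G)\ge\Delta(G)+\delta(G),\qquad \mathcal E(G)\ge 2\sqrt{\bar d(G)(n-1)}.$$ Moreover, if equality holds in either the second or the third of these inequalities, then $G\cong K_n$.
   Context: For a finite simple graph $G$ with $n$ vertices and $m$ edges, let $A(G)$ be its adjacency matrix with eigenvalues $\lambda_1\ge\cdots\ge\lambda_n$. The energy is $\mathcal E(G)=\sum_{i=1}^n|\lambda_i|$, and $\bar d(G)=2m/n$ is the average degree. $\Delta(G)$ and $\delta(G)$ are the maximum and minimum degrees. $G$ is nonsingular if $A(G)$ is nonsingular. $K_n$ is the complete graph on $n$ vertices. *)

(* Defs.v *)
From mathcomp Require Import all_boot all_order all_algebra.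
From mathcomp Require Import spectral sesquilinear reals complex.

Set Implicit Arguments.
Unset Strict Implicit.
Unset Printing Implicit Defensive.

Import Order.TTheory GRing.Theory Num.Theory.

Record sgraph := SGraph {
  vertex :> finType;
  adjacent : rel vertex;
  adjacent_sym : symmetric adjacent;
  adjacent_irrefl : irreflexive adjacent }.

Definition edges (G : sgraph) : {set {set G}} :=
  [set [set u.1; u.2] | u : G * G & adjacent u.1 u.2].

Definition degree (G : sgraph) (x : G) : nat := #|[set y | adjacent x y]|.

Definition max_degree (G : sgraph) : nat := \max_(x : G) degree x.

(* The default value #|G| is never attained by a degree, so it only matters
   for the graph without vertices. *)
Definition min_degree (G : sgraph) : nat := \big[minn/#|G|]_(x : G) degree x.

Lemma complete_sym n : symmetric (fun i j : 'I_n => i != j).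
Proof. by move=> i j; rewrite eq_sym. Qed.

Lemma complete_irrefl n : irreflexive (fun i j : 'I_n => i != j).
Proof. by move=> i; rewrite eqxx. Qed.

Definition complete (n : nat) : sgraph :=
  SGraph (@complete_sym n) (@complete_irrefl n).

Definition isomorphic (G H : sgraph) : Prop :=
  exists2 f : G -> H, bijective f &
    forall x y, adjacent (f x) (f y) = adjacent x y.

Local Open Scope ring_scope.

(* Rows and columns follow the canonical enumeration of the vertices. *)
Definition adjmx (R : nzRingType) (G : sgraph) : 'M[R]_#|G| :=
  \matrix_(i, j) (adjacent (enum_val i) (enum_val j))%:R.

Lemma adjmx_spectrum (R : realType) (G : sgraph) :
  exists s : seq R, char_poly (adjmx R G) == \prod_(x <- s) ('X - x%:P).
Proof.
pose A : 'M[R[i]]_#|G| := adjmx _ G.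
have Asym : A \is symmetricmx.
  apply/is_hermitianmxP; rewrite expr0 scale1r map_mx_id //.
  by apply/matrixP=> i j; rewrite !mxE adjacent_sym.
have Areal : A \is a realmx.
  by apply/mxOverP => i j; rewrite mxE realn.
have Aherm := realsym_hermsym Asym Areal.
have /orthomx_spectralP A_eq := hermitian_normalmx Aherm.
have /mxOverP Dreal := hermitian_spectral_diag_real Aherm.
set P := spectralmx A in A_eq; set D := spectral_diag A in A_eq Dreal.
have Pu : P \in unitmx by exact: spectral_unit.
have charA : char_poly A = \prod_i ('X - (D 0 i)%:P).
  have -> : char_poly A = char_poly (diag_mx D).
    rewrite /char_poly /char_poly_mx A_eq !map_mxM /=.
    set Q := map_mx polyC P; set Q' := map_mx polyC (invmx P).
    have QQ : Q' *m Q = 1%:M by rewrite -map_mxM mulVmx // map_mx1.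
    have XE : 'X%:M = Q' *m 'X%:M *m Q :> 'M[{poly R[i]}]_#|G|.
      by rewrite scalar_mxC -mulmxA QQ mulmx1.
    by rewrite [in LHS]XE -mulmxBl -mulmxBr !det_mulmx mulrAC -det_mulmx QQ det1 mul1r.
  rewrite char_poly_trig ?diag_mx_is_trig //.
  by apply: eq_bigr => i _; rewrite !mxE eqxx mulr1n.
exists [seq complex.Re (D 0 i) | i <- enum 'I_#|G|].
apply/eqP/(map_poly_inj (real_complex R)).
rewrite map_char_poly rmorph_prod big_map big_enum /=.
have -> : map_mx (real_complex R) (adjmx R G) = A.
  by apply/matrixP=> i j; rewrite !mxE rmorph_nat.
rewrite charA; apply: eq_bigr => i _.
by rewrite rmorphB /= map_polyX map_polyC /= RRe_real.
Qed.

(* The n eigenvalues with multiplicity, listed in nonincreasing order. *)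
Definition eigenvalues (R : realType) (G : sgraph) : seq R :=
  sort >=%R (xchoose (adjmx_spectrum R G)).

Lemma char_poly_eigenvalues (R : realType) (G : sgraph) :
  char_poly (adjmx R G) = \prod_(x <- eigenvalues R G) ('X - x%:P).
Proof.
rewrite (eqP (xchooseP (adjmx_spectrum R G))).
by apply: perm_big; rewrite perm_sym perm_sort.
Qed.

Lemma size_eigenvalues (R : realType) (G : sgraph) :
  size (eigenvalues R G) = #|G|.
Proof.
apply: succn_inj.
by rewrite -(size_char_poly (adjmx R G)) char_poly_eigenvalues size_prod_XsubC.
Qed.

Lemma eigenvalues_sorted (R : realType) (G : sgraph) :
  sorted >=%R (eigenvalues R G).
Proof. by apply: sort_sorted => x y; exact: le_total. Qed.

Definition energy (R : realType) (G : sgraph) : R :=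
  \sum_(x <- eigenvalues R G) `|x|.

Definition avg_degree (R : realType) (G : sgraph) : R :=
  (2 * #|edges G|)%:R / #|G|%:R.

Definition nonsingular (R : realType) (G : sgraph) : bool :=
  adjmx R G \in unitmx.

(* Main.v *)
From mathcomp Require Import boolp classical_sets functions topology normedtype.
From mathcomp Require Import sequences derive realfun exp.
From mathcomp Require Import all_boot all_order all_algebra reals.
From mathcomp Require Import spectral sesquilinear complex.
From mathcomp Require Import ring lra zify.
Require Import Defs.

(* The second and third inequalities follow from the first: the maximum degree is
   at most n - 1, the minimum degree at most the average degree d, and
   2 sqrt (d (n - 1)) <= d + (n - 1); equality forces d = n - 1.

   For the first inequality, let A be the adjacency matrix. As A is an invertible
   integer matrix, |det A| >= 1.

   If A has at least three positive eigenvalues, the conclusion follows from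
   sum ln |D i| >= 0, sum D i = 0, sum (D i)^2 = n d and max D i >= d alone.
   Negative eigenvalues are handled with ln (1 + x) <= x - 3 x^2 / (6 + 4 x);
   assuming the bound fails, the largest one is controlled by the traces, and an
   averaging argument reduces the other positive ones to two of them.

   Otherwise A is not positive semidefinite on any 3-dimensional space, so the
   complement H of G contains no triangle, no induced 2 K_2 and no induced
   5-cycle. Hence, for p of maximal degree in H and q of maximal degree among the
   H-neighbours of p, all edges of H lie between the H-neighbourhoods of p and q.
   As energy(G) >= 2 tr (A M) for every orthogonal projection M, two orthogonal
   test vectors suffice: the all-ones vector together with a vector constant on
   the two sides of H, or, when H is a double star with few isolated vertices,
   vectors constant on its natural cells. *)

Set Implicit Arguments.
Unset Strict Implicit.
Unset Printing Implicit Defensive.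

Import Order.TTheory GRing.Theory Num.Theory.
Import numFieldNormedType.Exports.
Local Open Scope ring_scope.

(** * Elementary inequalities for [ln] and [expR] *)

(** [f] is nonincreasing up to [a] and nondecreasing after it, so its zero at [a] is a minimum; [l]
    is the left end of the domain. *)
Lemma ge0_of_sign_derive (R : realType) (f f' : R -> R) (l a : R) :
  l < a -> f a = 0 -> (forall y, l < y -> is_derive y 1 f (f' y)) ->
  (forall y, l < y -> 0 <= (y - a) * f' y) ->
  forall x, l < x -> 0 <= f x.
Proof.
move=> la fa0 df sf x lx.
have contf b c : l < b -> {within `[b, c], continuous f}%classic.
  move=> lb; apply: derivable_within_continuous => y.
  rewrite in_itv/= => /andP[by_ _].
  by have [] := df y (lt_le_trans lb by_).
have [xa|ax|->] := ltgtP x a; last by rewrite fa0.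
- have [y||c] := @MVT R f f' x a xa.
    by rewrite in_itv/= => /andP[xy _]; exact: df (lt_trans lx xy).
    exact: contf.
  rewrite in_itv/= => /andP[xc ca]; rewrite fa0 => e.
  have := sf c (lt_trans lx xc).
  rewrite nmulr_rge0 ?subr_lt0// => f'c.
  have : f' c * (a - x) <= 0 by rewrite mulr_le0_ge0// subr_ge0 ltW.
  by rewrite -e sub0r oppr_le0.
- have [y||c] := @MVT R f f' a x ax.
    by rewrite in_itv/= => /andP[xy _]; exact: df (lt_trans la xy).
    exact: contf.
  rewrite in_itv/= => /andP[ac cx]; rewrite fa0 subr0 => ->.
  have := sf c (lt_trans la ac).
  rewrite pmulr_rge0 ?subr_gt0// => f'c.
  by rewrite mulr_ge0// subr_ge0 ltW.
Qed.

Lemma is_derive_affine (R : realType) (a b x : R) :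
  is_derive x 1 (fun y => a + b * y) b.
Proof.
have -> : (fun y => a + b * y) = (cst a + (b \*: id)) :> (R -> R) by [].
by apply: is_derive_eq; rewrite add0r /GRing.scale/= mulr1.
Qed.

(* The right-hand side agrees with [ln (1 + x)] to third order at 0. *)
Lemma ln1D_le_pade (R : realType) (x : R) : -1 < x ->
  ln (1 + x) <= x - 3 * x ^+ 2 / (6 + 4 * x).
Proof.
move=> x1; rewrite -subr_ge0.
(* Partial fractions of the rational part; the derivative of [f] collapses to
   [4 y^3 / ((6 + 4 y)^2 (1 + y))], which has the sign of [y]. *)
pose f (y : R) := (9 / 8 + 4^-1 * y) + (- (27 / 4)) * (6 + 4 * y)^-1 - ln (1 + 1 * y).
have -> : x - 3 * x ^+ 2 / (6 + 4 * x) - ln (1 + x) = f x.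
  rewrite /f mul1r; congr (_ - _); field; lra.
apply: (@ge0_of_sign_derive R f
   (fun y => 1 / 4 + 27 * (6 + 4 * y) ^- 2 - (1 + y)^-1) (-1) 0); last exact: x1.
- by rewrite ltrN10.
- by rewrite /f !mulr0 !addr0 ln1; field.
- move=> y y1.
  have y0 : 6 + 4 * y != 0 by lra.
  have y2 : 0 < 1 + 1 * y by lra.
  have dV := @is_deriveV R (fun z => 6 + 4 * z) y 4 1 y0 (is_derive_affine 6 4 y).
  have dL := @is_derive1_comp R (@ln R) (fun z => 1 + 1 * z) y _ 1 (is_derive1_ln y2) (is_derive_affine 1 1 y).
  have d := is_deriveB (is_deriveD (is_derive_affine (9 / 8) 4^-1 y)
    (is_deriveZ (- (27 / 4)) dV)) dL.
  apply: (is_derive_eq d); rewrite /GRing.scale/=.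
  by field; rewrite y0/=; lra.
- move=> y y1; rewrite subr0.
  have -> : y * (1 / 4 + 27 * (6 + 4 * y) ^- 2 - (1 + y)^-1)
    = 4 * (y ^+ 2) ^+ 2 * ((6 + 4 * y) ^- 2 * (1 + y)^-1).
    by field; lra.
  have y2 : 0 <= 1 + y by lra.
  apply: mulr_ge0; first by rewrite pmulr_rge0 ?sqr_ge0.
  by apply: mulr_ge0; rewrite invr_ge0 ?sqr_ge0.
Qed.

(** The derivative of the error is the error at degree 2, which is increasing and vanishes at 0,
    hence has the sign of its argument. This covers negative [x] as well. *)
Lemma expR_ge_taylor3 (R : realType) (x : R) :
  1 + x + x ^+ 2 / 2 + x ^+ 3 / 6 <= expR x.
Proof.
rewrite -subr_ge0.
pose f2 (y : R) := expR y - ((1 + 1 * y) + 2^-1 * y ^+ 2).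
have df2 (y : R) : is_derive y 1 f2 (expR y - (1 + y)).
  have d := is_deriveB (is_derive_expR y) (is_deriveD (is_derive_affine 1 1 y)
    (is_deriveZ 2^-1 (@is_deriveX _ _ id 2 y 1 1 (is_derive_id y 1)))).
  by apply: (is_derive_eq d); rewrite /GRing.scale/=; field.
have mono a b : a <= b -> f2 a <= f2 b.
  move=> ab; have [|c _ e] := @MVT_segment R f2 _ a b ab (fun y _ => df2 y).
  - by apply: derivable_within_continuous => y _; have [] := df2 y.
  by rewrite -subr_ge0 e mulr_ge0// subr_ge0 ?expR_ge1Dx.
have f20 : f2 0 = 0 by rewrite /f2 expR0; ring.
pose f (y : R) := expR y - ((1 + 1 * y) + (2^-1 * y ^+ 2 + 6^-1 * y ^+ 3)).
have -> : expR x - (1 + x + x ^+ 2 / 2 + x ^+ 3 / 6) = f x.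
  by rewrite /f; ring.
apply: (@ge0_of_sign_derive R f f2 (Num.min x 0 - 1) 0).
- by rewrite ltrBlDr add0r gt_min ltr01 orbT.
- by rewrite /f expR0; ring.
- move=> y _.
  have d := is_deriveB (is_derive_expR y) (is_deriveD (is_derive_affine 1 1 y)
    (is_deriveD (is_deriveZ 2^-1 (@is_deriveX _ _ id 2 y 1 1 (is_derive_id y 1)))
       (is_deriveZ 6^-1 (@is_deriveX _ _ id 3 y 1 1 (is_derive_id y 1))))).
  by apply: (is_derive_eq d); rewrite /GRing.scale/= /f2; field.
- move=> y _; rewrite subr0.
  have [y0|/ltW y0] := leP 0 y.
    by rewrite mulr_ge0// -f20 mono.
  by rewrite mulr_le0// -f20 mono.
- by rewrite ltrBlDr gt_min ltrDl ltr01.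
Qed.

(** The quartic is exactly the sum of the three nonnegative terms below. It is the numerator left in
    [sqr_add_le_expR] at [b = 31 / 10], up to a factor [X ^+ 2]. *)
Lemma pade_quartic_ge0 (R : realType) (X : R) : 0 <= X ->
  0 <= 1188 / 10 + 144 / 10 * X - 555 / 10 * X ^+ 2 - 82 / 10 * X ^+ 3
       + 1395 / 100 * X ^+ 4.
Proof.
move=> X0; have s1 := sqr_ge0 (37 / 10 * X ^+ 2 - 11 / 10 * X - 8).
have s2 : 0 <= X ^+ 2 * (26 / 100 * X ^+ 2 - 6 / 100 * X + 1).
  by apply: mulr_ge0; [exact: sqr_ge0 | nra].
have s3 : 0 <= 149 / 100 * X ^+ 2 - 32 / 10 * X + 548 / 10 by nra.
lra.
Qed.

(** This is the numerator left in [sqr_add_le_expR] at [b = 2]. *)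
Lemma pade_sextic_ge0 (R : realType) (X : R) : 0 <= X ->
  0 <= 1512 / 10 + 3024 / 10 * X + 2772 / 10 * X ^+ 2 + 16 / 10 * X ^+ 3
       - 855 / 10 * X ^+ 4 - 154 / 10 * X ^+ 5 + 1215 / 100 * X ^+ 6.
Proof.
move=> X0; have X3 : 0 <= X ^+ 3 by rewrite exprn_ge0.
have [Xs|Xl] := leP X 2.
  have s1 : 0 <= X ^+ 4 * (1215 / 100 * X ^+ 2 - 154 / 10 * X + 5).
    apply: mulr_ge0; first by rewrite exprn_ge0.
    by have := sqr_ge0 (X - 154 / 243); lra.
  have s2 : 0 <= X ^+ 2 * ((2 - X) * (2 + X)).
    by apply: mulr_ge0; [exact: sqr_ge0 | apply: mulr_ge0; lra].
  have s3 : 0 <= X * (2 - X) by apply: mulr_ge0; lra.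
  lra.
pose y := X - 2; have y0 : 0 <= y by rewrite /y; lra.
have XE : X = y + 2 by rewrite /y; lra.
have y3 : 0 <= y ^+ 3 by rewrite exprn_ge0.
have y4 : 0 <= y ^+ 4 by rewrite exprn_ge0.
have y5 : 0 <= y ^+ 5 by rewrite exprn_ge0.
have y6 : 0 <= y ^+ 6 by rewrite exprn_ge0.
(* Five halves of the part of degree at most 3 in the expansion at [X = 2]; the coefficients of
   higher degree are positive. *)
have s1 : 0 <= 1986 - 512 * y - 203 * y ^+ 2 + 1614 * y ^+ 3.
  have [ys|/ltW yl] := leP y 1; first by nra.
  have : 0 <= y ^+ 2 * (y - 1) by apply: mulr_ge0; [exact: sqr_ge0 | lra].
  have : 0 <= y * (y - 1) by apply: mulr_ge0; lra.
  lra.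
by rewrite XE; lra.
Qed.

(** For [b = 2] and [b = 31 / 10] the exponential is replaced by its cubic Taylor polynomial and the
    denominator [(6 + 4 X) ^+ 3] is cleared. At [b = 31 / 10] the factor is [31 / 10] itself, with
    equality at [X = 0]. *)
Lemma sqr_add_le_expR (R : realType) (b X : R) : 2 <= b -> b <= 31 / 10 -> 0 <= X ->
  X ^+ 2 + b <= (27 / 10 + 4 / 11 * (b - 2)) * expR (3 * X ^+ 2 / (6 + 4 * X)).
Proof.
move=> b2 b3 X0; set g := 3 * X ^+ 2 / (6 + 4 * X).
have D0 : 0 < 6 + 4 * X by lra.
have D1 : 6 + 4 * X != 0 by rewrite gt_eqF.
have e3 := expR_ge_taylor3 g.
have h1 : X ^+ 2 + 31 / 10 <= 31 / 10 * expR g.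
  apply: le_trans (_ : 31 / 10 * (1 + g + g ^+ 2 / 2 + g ^+ 3 / 6) <= _); last by lra.
  rewrite -subr_ge0 -(pmulr_rge0 _ (exprn_gt0 3 D0)).
  rewrite [leRHS](_ : _ = X ^+ 2 * (1188 / 10 + 144 / 10 * X - 555 / 10 * X ^+ 2
      - 82 / 10 * X ^+ 3 + 1395 / 100 * X ^+ 4)); last by rewrite /g; field; exact: D1.
  by rewrite mulr_ge0 ?sqr_ge0 ?pade_quartic_ge0.
have h2 : X ^+ 2 + 2 <= 27 / 10 * expR g.
  apply: le_trans (_ : 27 / 10 * (1 + g + g ^+ 2 / 2 + g ^+ 3 / 6) <= _); last by lra.
  rewrite -subr_ge0 -(pmulr_rge0 _ (exprn_gt0 3 D0)).
  rewrite [leRHS](_ : _ = 1512 / 10 + 3024 / 10 * X + 2772 / 10 * X ^+ 2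
      + 16 / 10 * X ^+ 3 - 855 / 10 * X ^+ 4 - 154 / 10 * X ^+ 5
      + 1215 / 100 * X ^+ 6); last by rewrite /g; field; exact: D1.
  exact: pade_sextic_ge0.
(* Both sides are affine in [b]: interpolate between [b = 2] and [b = 31 / 10]. *)
set t := (b - 2) * (10 / 11).
have t0 : 0 <= t by rewrite /t; lra.
have t1 : 0 <= 1 - t by rewrite /t; lra.
have := lerD (ler_wpM2l t1 h2) (ler_wpM2l t0 h1).
by congr (_ <= _); rewrite /t; field.
Qed.

Lemma cubic_le_expR (R : realType) (s : R) : 0 < s ->
  s * (27 / 10 + 2 / 11 * s ^+ 2) <= 8 * expR (s - 2).
Proof.
move=> s0.
(* The exponential is expanded around [s = 6 / 5], close to where the two sides are nearest. The
   constant [251 / 375] is the cubic Taylor value at [- 2 / 5]; its square bounds the factor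
   [expR (- 4 / 5)]. *)
have -> : s - 2 = 2%:R * (- (2 / 5)) + (s - 6 / 5) by field.
rewrite expRD expRM_natl.
have e0 : 251 / 375 <= expR (- (2 / 5)) :> R.
  by apply: le_trans (expR_ge_taylor3 _); lra.
have e1 : (251 / 375) ^+ 2 <= expR (- (2 / 5)) ^+ 2 :> R by nra.
set w := s - 6 / 5.
have e2 := expR_ge_taylor3 w.
have T0 : 0 <= 1 + w + w ^+ 2 / 2 + w ^+ 3 / 6.
  have ? : - (6 / 5) < w by rewrite /w; lra.
  nra.
apply: le_trans (_ : 8 * ((251 / 375) ^+ 2 * (1 + w + w ^+ 2 / 2 + w ^+ 3 / 6)) <= _).
  have m1 := sqr_ge0 (s - 289 / 250).
  have m2 : 0 <= s * (s - 289 / 250) ^+ 2 by rewrite mulr_ge0 ?(ltW s0).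
  by rewrite /w; lra.
rewrite ler_wpM2l//; apply: ler_pM => //; exact: sqr_ge0.
Qed.

(** Once [expR u] is bounded below by [(1 + u / 4) ^+ 4] with [u = s - 2], the difference of the two
    sides is exactly [(s - 2) ^+ 4 / 32]. *)
Lemma quartic_le_expR (R : realType) (s : R) : 0 < s ->
  s * (2 + s ^+ 2 / 2) <= 8 * expR (s - 2).
Proof.
move=> s0.
have -> : s - 2 = 4%:R * ((s - 2) / 4) by field.
rewrite expRM_natl.
apply: le_trans (_ : 8 * (1 + (s - 2) / 4) ^+ 4 <= _).
  by have := sqr_ge0 ((s - 2) ^+ 2); lra.
by rewrite ler_wpM2l// lerXn2r ?nnegrE ?expR_ge0 ?expR_ge1Dx//; lra.
Qed.

(** In the application [s] is the sum of two positive eigenvalues and [X] measures how far the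
    negative eigenvalues are from -1. *)
Lemma pair_bound (R : realType) (s X : R) : 0 < s -> 0 <= X ->
  s * (X ^+ 2 + 2 + s ^+ 2 / 2) <= 8 * expR (s - 2 + 3 * X ^+ 2 / (6 + 4 * X)).
Proof.
move=> s0 X0; rewrite expRD -[X ^+ 2 + 2 + _]addrA.
set E := expR (3 * _ / _); have E0 : 0 <= E by exact: expR_ge0.
(* The threshold is where [b = 2 + s ^+ 2 / 2] reaches [31 / 10]. Beyond it, the bound at [31 / 10]
   extends to [b] because [E >= 1]. *)
have [s2|/ltW s2] := leP (s ^+ 2) (22 / 10).
  have h := @sqr_add_le_expR R (2 + s ^+ 2 / 2) X _ _ X0.
  apply: le_trans (_ : s * ((27 / 10 + 2 / 11 * s ^+ 2) * E) <= _).
    rewrite ler_wpM2l ?(ltW s0)//.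
    have -> : 27 / 10 + 2 / 11 * s ^+ 2 = 27 / 10 + 4 / 11 * (2 + s ^+ 2 / 2 - 2) by field.
    by apply: h; have := sqr_ge0 s; lra.
  by rewrite !mulrA ler_wpM2r// -mulrA cubic_le_expR.
have h := @sqr_add_le_expR R (31 / 10) X _ (lexx _) X0.
apply: le_trans (_ : s * ((2 + s ^+ 2 / 2) * E) <= _); last first.
  by rewrite !mulrA ler_wpM2r// quartic_le_expR.
rewrite ler_wpM2l ?(ltW s0)//.
have {}h : X ^+ 2 + 31 / 10 <= 31 / 10 * E.
  by apply: le_trans (h _) _; [lra | rewrite ler_wpM2r//; lra].
have X2 := sqr_ge0 X.
have E1 : 1 <= E by lra.
nra.
Qed.

(** * Three positive eigenvalues *)

(** Take the two largest values: were their sum negative, the second would be negative, hence all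
    the remaining ones, and so would the total. *)
Lemma exists_pair_sum_ge0 (R : realType) (I : finType) (P : pred I) (h : I -> R)
    (i1 i2 : I) : P i1 -> P i2 -> i1 != i2 -> 0 <= \sum_(i | P i) h i ->
  exists i j, [/\ P i, P j, i != j & 0 <= h i + h j].
Proof.
move=> P1 P2 i12 h0.
case: (@arg_maxP _ _ _ i1 P h P1) => i Pi maxi.
pose P' := [pred k | P k & k != i].
have [j0 Pj0] : exists j0, P' j0.
  have [e|ne] := eqVneq i1 i; last by exists i1; rewrite /= P1.
  by exists i2; rewrite /= P2 -e eq_sym.
case: (@arg_maxP _ _ _ j0 P' h Pj0) => j /andP[Pj ji] maxj.
exists i, j; split=> //; first by rewrite eq_sym.
rewrite leNgt; apply/negP => hij; move: h0; apply/negP; rewrite -ltNge.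
rewrite (bigD1 i)//= (bigD1 j) /=; last by rewrite Pj.
rewrite addrA ltr_wnDr//.
apply: sumr_le0 => k /andP[Pk kj].
have hk := maxj k Pk; have hj := maxi j Pj.
by apply: le_trans hk _; rewrite /= in hj; lra.
Qed.

(** The function [p (K - 2 p)] increases up to [p = K / 4], and [x y <= (x + y)^2 / 4 <= K / 4]. *)
Lemma prod_le_sqr_sum (R : realType) (K x y : R) : (x + y) ^+ 2 <= K ->
  x * y * (K - 2 * (x * y)) <= (x + y) ^+ 2 / 4 * (K - (x + y) ^+ 2 / 2).
Proof.
move=> h; rewrite -subr_ge0.
rewrite [leRHS](_ : _ = (x - y) ^+ 2 / 4 * (K - 2 * ((x + y) ^+ 2 / 4 + x * y))); last by field.
apply: mulr_ge0; first by have := sqr_ge0 (x - y); lra.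
have := sqr_ge0 (x - y); lra.
Qed.

Lemma sum_split_sign (R : realType) (I : finType) (D : I -> R) (i0 : I) (F : I -> R) :
  (forall i, D i != 0) -> 0 < D i0 ->
  \sum_i F i = F i0 + \sum_(i | (i != i0) && (0 < D i)) F i + \sum_(i | D i < 0) F i.
Proof.
move=> D0 D00; rewrite (bigD1 i0)//= -addrA; congr (_ + _).
rewrite (bigID (fun i => 0 < D i))/=; congr (_ + _); apply: eq_bigl => i.
rewrite -leNgt le_eqVlt (negPf (D0 i))/=.
by have [->|] := eqVneq i i0; rewrite //= [RHS]lt_gtF.
Qed.

Section ThreePositive.
Variables (R : realType) (I : finType) (D : I -> R) (d : R) (i0 : I).
Hypotheses (D0 : forall i, D i != 0) (Di0 : 0 < D i0) (di0 : d <= D i0).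
Hypotheses (sumD : \sum_i D i = 0) (sumD2 : \sum_i D i ^+ 2 = #|I|%:R * d).
Hypothesis (sumln : 0 <= \sum_i ln `|D i|).

Let pos i := (i != i0) && (0 < D i).
Let neg i := D i < 0.

Variables (p1 p2 : I).
Hypotheses (pos1 : pos p1) (pos2 : pos p2) (p12 : p1 != p2).

(** If the bound fails, the traces give [ln l <= ln c + (l - d)] with [c = C / (2 s)]. Then the
    logarithmic hypothesis becomes a strict inequality on the other positive eigenvalues, which
    [pair_bound] refutes for a suitable pair. *)
Lemma core_bound : #|I|%:R - 1 + d <= \sum_i `|D i|.
Proof.
rewrite leNgt; apply/negP => hE.
have split3 F := @sum_split_sign R I D i0 F D0 Di0.
pose l := D i0; pose s := \sum_(i | pos i) D i; pose a : R := \sum_(i | pos i) 1.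
pose q : R := \sum_(i | neg i) 1; pose Y := \sum_(i | pos i) D i ^+ 2.
pose N := \sum_(i | neg i) D i; pose N2 := \sum_(i | neg i) D i ^+ 2.
pose Q := \sum_(i | neg i) (D i + 1) ^+ 2.
have e1 : l + s + N = 0 by rewrite -sumD split3.
have e2 : l ^+ 2 + Y + N2 = #|I|%:R * d by rewrite -sumD2 split3.
have e3 : #|I|%:R = 1 + a + q :> R.
  rewrite -(split3 (fun=> 1)) sumr_const -mulr_natl mulr1 //.
have e4 : \sum_i `|D i| = l + s - N.
  rewrite split3 -sumrN (gtr0_norm Di0); congr (_ + _ + _).
    by apply: eq_bigr => i /andP[_ ?]; rewrite gtr0_norm.
  by apply: eq_bigr => i ?; rewrite ltr0_norm.
have QE : Q = N2 + 2 * N + q.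
  rewrite /Q /N2 /N /q mulr_sumr -!big_split/=; apply: eq_bigr => i _; ring.
have Q0 : 0 <= Q by apply: sumr_ge0 => i _; exact: sqr_ge0.
(* [X] bounds every [- D i - 1], so one value of the decreasing Pade factor serves
   all negative eigenvalues. *)
pose X := Num.sqrt Q; have X0 : 0 <= X by exact: sqrtr_ge0.
have XQ : X ^+ 2 = Q by rewrite sqr_sqrtr.
pose k := 3 / (6 + 4 * X).
have k0 : 0 <= k by rewrite /k divr_ge0//; lra.
have lnneg : \sum_(i | neg i) ln `|D i| <= - N - q - k * Q.
  rewrite /N /q /Q mulr_sumr -!sumrN -!big_split/=; apply: ler_sum => i Di.
  rewrite ltr0_norm//.
  have -> : - D i = 1 + (- D i - 1) by ring.
  rewrite /neg in Di.
  have mu1 : -1 < - D i - 1 by lra.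
  have muX : - D i - 1 <= X.
    apply: le_trans (ler_norm _) _.
    rewrite -sqrtr_sqr ler_wsqrtr// /Q (bigD1 i)//=.
    rewrite [leLHS](_ : _ = (D i + 1) ^+ 2); last by ring.
    by rewrite lerDl; apply: sumr_ge0 => j _; exact: sqr_ge0.
  apply: le_trans (ln1D_le_pade mu1) _.
  set m := - D i - 1 in mu1 muX *.
  have -> : (D i + 1) ^+ 2 = m ^+ 2 by rewrite /m; ring.
  have -> : 1 + m - 1 - k * m ^+ 2 = m - k * m ^+ 2 by ring.
  rewrite lerD2l lerN2 [leRHS]mulrAC ler_wpM2r ?sqr_ge0//.
  rewrite /k ler_wpM2l//.
  by rewrite lef_pV2 ?posrE; lra.
have ys i : pos i -> 0 < D i by case/andP.
have s0 : 0 < s.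
  rewrite /s (bigD1 p1)//= ltr_pwDl ?ys//.
  by apply: sumr_ge0 => i /andP[/ys/ltW].
have a2 : 2 <= a.
  rewrite /a (bigD1 p1)//= (bigD1 p2)/=; last by rewrite pos2 eq_sym.
  rewrite addrA -[2]/(1 + 1) lerDl.
  by apply: sumr_ge0.
have Y0 : 0 <= Y by apply: sumr_ge0 => i _; exact: sqr_ge0.
have Ys : 2 * s <= a + Y.
  rewrite /s mulr_sumr /a /Y -big_split/=; apply: ler_sum => i _.
  by have := sqr_ge0 (D i - 1); lra.
pose dl := l - d; have dl0 : 0 <= dl by rewrite /dl subr_ge0.
pose C := Q + a + Y.
have d0 : 0 <= d.
  have : 0 <= #|I|%:R * d by rewrite -sumD2; apply: sumr_ge0 => i _; exact: sqr_ge0.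
  by rewrite pmulr_rge0// e3; have : 0 <= q by [apply: sumr_ge0]; lra.
have hE' : 2 * s < a + q + d - 2 * l by lra.
(* By the two traces, [C + dl^2 - (a + q + d - 2 l) d = a + q + d - 2 l - 2 s], which is positive by
   [hE']. *)
have hd : 2 * s * d <= C + dl ^+ 2.
  apply: le_trans (_ : (a + q + d - 2 * l) * d <= _).
    by rewrite ler_wpM2r// ltW.
  have NE : N = - (l + s) by lra.
  have N2E : N2 = (1 + a + q) * d - l ^+ 2 - Y by rewrite -e3; lra.
  rewrite /C QE NE N2E /dl -subr_ge0.
  set u := (X in 0 <= X).
  have -> : u = a + q + d - 2 * l - 2 * s by rewrite /u; ring.
  by lra.
pose c := C / (2 * s).
have C2 : 2 <= C by rewrite /C; lra.
have Cs : 2 * s <= C by rewrite /C; lra.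
have c0 : 0 < c by rewrite /c divr_gt0//; lra.
(* Write [l = d + dl] and bound [2 s d] by [hd]; then [2 s <= C] and [2 <= C] absorb the terms in
   [dl] and [dl ^+ 2] into the quadratic Taylor polynomial. *)
have hl : l <= c * expR dl.
  have s20 : 0 < 2 * s by lra.
  rewrite -(ler_pM2l s20) mulrA (_ : 2 * s * c = C); last by rewrite /c; field; lra.
  apply: le_trans (_ : C * (1 + dl + dl ^+ 2 / 2) <= _); last first.
    rewrite ler_wpM2l//; first by lra.
    apply: le_trans (expR_ge_taylor3 dl).
    by rewrite lerDl; have := exprn_ge0 3 dl0; lra.
  have -> : l = d + dl by rewrite /dl; ring.
  have h1 : 2 * s * dl <= C * dl by rewrite ler_wpM2r.
  have h2 : 2 * dl ^+ 2 <= C * dl ^+ 2 by rewrite ler_wpM2r ?sqr_ge0.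
  lra.
have hlnl : ln l <= ln c + dl.
  have e0 := expR_gt0 dl.
  rewrite -[dl in leRHS]expRK -lnM ?posrE//.
  by rewrite ler_ln ?posrE// mulr_gt0.
(* The bounds on [ln l] and on the negative eigenvalues are inserted in [sumln]; by [hE'] the
   leftover linear terms sum to something negative, whence the strict sign. *)
have main : 0 < ln c + \sum_(i | pos i) (ln (D i) + 1 - D i) - k * Q.
  have -> : \sum_(i | pos i) (ln (D i) + 1 - D i) =
    \sum_(i | pos i) ln (D i) + a - s.
    by rewrite /a /s -sumrN -!big_split.
  move: sumln; rewrite split3 (gtr0_norm Di0) -/l.
  have -> : \sum_(i | (i != i0) && (0 < D i)) ln `|D i| = \sum_(i | pos i) ln (D i).
    by apply: eq_bigr => i /ys ?; rewrite gtr0_norm.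
  rewrite -/neg; move: lnneg; rewrite /dl in hlnl.
  move: (\sum_(i | neg i) _) (\sum_(i | pos i) _) => u v; lra.
(* Averaging over the pairs selects two positive eigenvalues controlled by [c];
   all other terms [ln y + 1 - y] are at most 0 and can be dropped. *)
have [i [j [Pi Pj ij hij]]] : exists i j, [/\ pos i, pos j, i != j &
    2 * c * (D i + D j) <= Q + 2 + D i ^+ 2 + D j ^+ 2].
  have a0 : a != 0 by lra.
  (* The constant [c] is chosen so that these values sum to [C - 2 c s = 0]. For a pair,
     [2 Q / a <= Q] since [a >= 2]. *)
  have [|i [j [Pi Pj ij h]]] := @exists_pair_sum_ge0 R I pos
    (fun i => (Q / a + 1 + D i ^+ 2) - 2 * c * D i) p1 p2 pos1 pos2 p12.
    rewrite sumrB -mulr_sumr !big_split/= -/Y -/s -/a.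
    have -> : \sum_(i | pos i) Q / a = Q.
      transitivity (Q / a * a); last by field.
      by rewrite /a mulr_sumr; apply: eq_bigr => i _; rewrite mulr1.
    rewrite [leRHS](_ : _ = 0)// /c /C; field; lra.
  exists i, j; split=> //.
  have : 2 * (Q / a) <= Q.
    rewrite mulrA ler_pdivrMr; last by lra.
    by rewrite mulrC ler_wpM2l.
  lra.
have Dip := ys _ Pi; have Djp := ys _ Pj.
have {}main : 0 < ln c + ln (D i) + ln (D j) + 2 - (D i + D j) - k * Q.
  apply: lt_le_trans main _.
  rewrite (bigD1 i)//= (bigD1 j)/=; last by rewrite Pj eq_sym.
  have : \sum_(m | pos m && (m != i) && (m != j)) (ln (D m) + 1 - D m) <= 0.
    apply: sumr_le0 => m /andP[/andP[Pm _] _].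
    have Dm := ys _ Pm; have Dm1 : -1 < D m - 1 by lra.
    by have := le_ln1Dx Dm1; rewrite [1 + _]addrC subrK; lra.
  lra.
(* The choice of the pair bounds [2 c t] times the product; [prod_le_sqr_sum] with
   [K = Q + 2 + t ^+ 2] leaves an expression in [t] alone, to which [pair_bound] applies. The result
   contradicts [main]. *)
have cDD : c * D i * D j <= expR (D i + D j - 2 + k * Q).
  set t := D i + D j in hij main *.
  have t0 : 0 < t by rewrite addr_gt0.
  have hb := @pair_bound R t X t0 X0; rewrite XQ in hb.
  have -> : k * Q = 3 * Q / (6 + 4 * X) by rewrite /k mulrAC.
  have h1 := @prod_le_sqr_sum R (Q + 2 + t ^+ 2) (D i) (D j) ltac:(rewrite -/t; lra).
  rewrite -/t in h1.
  have h2 : 2 * c * t * (D i * D j) <= (Q + 2 + D i ^+ 2 + D j ^+ 2) * (D i * D j).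
    by rewrite ler_wpM2r// mulr_ge0// ltW.
  have h3 : (Q + 2 + D i ^+ 2 + D j ^+ 2) * (D i * D j) =
    D i * D j * (Q + 2 + t ^+ 2 - 2 * (D i * D j)) by rewrite /t; ring.
  have h4 : 2 * t * (c * D i * D j) <= t * (t * (Q + 2 + t ^+ 2 / 2)) / 4.
    rewrite [leLHS](_ : _ = 2 * c * t * (D i * D j)); last by ring.
    apply: le_trans h2 _; rewrite h3; apply: le_trans h1 _.
    by rewrite le_eqVlt; apply/orP; left; apply/eqP; field.
  have h5 : t * (t * (Q + 2 + t ^+ 2 / 2)) <= t * (8 * expR (t - 2 + 3 * Q / (6 + 4 * X))).
    by rewrite ler_wpM2l// ltW.
  have t2 : 0 < 2 * t by lra.
  rewrite -(ler_pM2l t2); lra.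
have cD : 0 < c * D i by apply: mulr_gt0.
have cDp : 0 < c * D i * D j by apply: mulr_gt0.
have : ln (c * D i * D j) <= D i + D j - 2 + k * Q.
  by rewrite -[leRHS]expRK ler_ln ?posrE ?expR_gt0.
rewrite lnM ?posrE// lnM ?posrE//.
lra.
Qed.

End ThreePositive.

(** * Spectral theorem for real symmetric matrices *)

Section Spectral.
Local Open Scope complex_scope.
Local Open Scope sesquilinear_scope.

Lemma real_sym_spectral (R : realType) (n : nat) (A : 'M[R]_n) : A^T = A ->
  exists (P : 'M[R[i]]_n) (D : 'I_n -> R), P \is unitarymx /\
    map_mx (real_complex R) A = P^t* *m diag_mx (\row_i (D i)%:C) *m P.
Proof.
move=> Asym; set B := map_mx (real_complex R) A.
have Bsym : B \is symmetricmx.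
  apply/is_hermitianmxP; rewrite expr0 scale1r map_mx_id //.
  by apply/matrixP=> i j; rewrite !mxE -[in RHS]Asym mxE.
have Breal : B \is a realmx.
  by apply/mxOverP => i j; rewrite mxE complex_real.
have Bherm := realsym_hermsym Bsym Breal.
have /orthomx_spectralP B_eq := hermitian_normalmx Bherm.
have /mxOverP Dreal := hermitian_spectral_diag_real Bherm.
exists (spectralmx B), (fun i => complex.Re (spectral_diag B 0 i)).
split; first exact: spectral_unitarymx.
rewrite -invmx_unitary ?spectral_unitarymx// [LHS]B_eq.
congr (_ *m diag_mx _ *m _).
by apply/rowP => i; rewrite mxE RRe_real.
Qed.

Lemma unitary_similar_char_poly (F : numClosedFieldType) (n : nat) (P B : 'M[F]_n) :
  P \is unitarymx -> char_poly (P^t* *m B *m P) = char_poly B.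
Proof.
move=> Pu; rewrite -invmx_unitary// /char_poly /char_poly_mx !map_mxM /=.
have Punit := unitarymx_unit Pu.
set Q := map_mx polyC P; set Q' := map_mx polyC (invmx P).
have QQ : Q' *m Q = 1%:M by rewrite -map_mxM mulVmx // map_mx1.
have XE : 'X%:M = Q' *m 'X%:M *m Q :> 'M[{poly F}]_n.
  by rewrite scalar_mxC -mulmxA QQ mulmx1.
by rewrite [in LHS]XE -mulmxBl -mulmxBr !det_mulmx mulrAC -det_mulmx QQ det1 mul1r.
Qed.

Section Diagonalized.
Variables (R : realType) (n : nat) (A : 'M[R]_n) (P : 'M[R[i]]_n) (D : 'I_n -> R).
Hypothesis (Pu : P \is unitarymx).
Hypothesis (AE : map_mx (real_complex R) A = P^t* *m diag_mx (\row_i (D i)%:C) *m P).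

Let PP : P *m P^t* = 1%:M. Proof. exact/unitarymxP. Qed.

Lemma char_poly_spectral : char_poly A = \prod_i ('X - (D i)%:P).
Proof.
apply: (map_poly_inj (real_complex R)).
rewrite map_char_poly AE unitary_similar_char_poly// rmorph_prod/=.
rewrite char_poly_trig ?diag_mx_is_trig //.
by apply: eq_bigr => i _; rewrite !mxE eqxx mulr1n rmorphB /= map_polyX map_polyC.
Qed.

Lemma det_spectral : \det A = \prod_i D i.
Proof.
apply: (fmorph_inj (real_complex R)); rewrite -det_map_mx AE rmorph_prod.
rewrite !det_mulmx mulrAC mulrC -det_mulmx.
rewrite (mulmx1C PP) det1 mulr1 det_diag.
by apply: eq_bigr => i _; rewrite mxE.
Qed.

Lemma trace_spectral : \tr A = \sum_i D i.
Proof.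
apply: complexI; rewrite [RHS]rmorph_sum.
transitivity (\tr (map_mx (real_complex R) A)); first by rewrite trace_map_mx.
rewrite AE -mulmxA mxtrace_mulC -mulmxA PP mulmx1 mxtrace_diag.
by apply: eq_bigr => i _; rewrite mxE.
Qed.

Lemma trace_sqr_spectral : \tr (A *m A) = \sum_i D i ^+ 2.
Proof.
apply: complexI; rewrite [RHS]rmorph_sum.
transitivity (\tr (map_mx (real_complex R) (A *m A))); first by rewrite trace_map_mx.
rewrite map_mxM AE !mulmxA -[_ *m P *m P^t*]mulmxA PP mulmx1 -!mulmxA mxtrace_mulC.
rewrite -!mulmxA PP mulmx1 mulmx_diag mxtrace_diag.
by apply: eq_bigr => i _; rewrite !mxE -rmorphM.
Qed.

(** The weights are the diagonal entries of [M] in the eigenbasis. There [N] is Hermitian and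
    idempotent, so [N i i] is the squared norm of its row, hence at least its own square. *)
Lemma proj_weights (M : 'M[R]_n) : M^T = M -> M *m M = M ->
  exists w : 'I_n -> R, [/\ forall i, 0 <= w i <= 1, \sum_i w i = \tr M
    & \tr (A *m M) = \sum_i D i * w i].
Proof.
move=> Msym Midem; set Mc := map_mx (real_complex R) M.
pose N := P *m Mc *m P^t*.
have Mch : Mc^t* = Mc.
  apply/matrixP => i j; rewrite !mxE -[in RHS]Msym mxE.
  by apply/CrealP; rewrite complex_real.
have Nh : N^t* = N.
  by rewrite /N trmx_mul map_mxM trmxCK trmx_mul map_mxM Mch mulmxA.
have NN : N *m N = N.
  rewrite /N !mulmxA -[_ *m P^t* *m P]mulmxA (mulmx1C PP) mulmx1.
  by rewrite -[P *m Mc *m Mc]mulmxA -map_mxM Midem.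
have Nii i : N i i = \sum_j `|N i j| ^+ 2.
  rewrite -{1}NN mxE; apply: eq_bigr => j _.
  by rewrite normCK -{2}Nh !mxE.
have Nii0 i : 0 <= N i i by rewrite Nii; apply: sumr_ge0 => j _; rewrite exprn_ge0.
pose w i := complex.Re (N i i).
have wE i : (w i)%:C = N i i by rewrite RRe_real// ger0_real.
exists w; split.
- move=> i; have w0 : 0 <= w i by rewrite -ler0c wE.
  rewrite w0/=; have : `|N i i| ^+ 2 <= N i i.
    rewrite {2}Nii (bigD1 i)//= lerDl.
    by apply: sumr_ge0 => j _; rewrite exprn_ge0.
  rewrite ger0_norm// -wE -rmorphXn lecR; nra.
- apply: complexI; rewrite rmorph_sum/=; under eq_bigr do rewrite wE.
  have -> : \sum_i N i i = \tr N by [].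
  rewrite /N mxtrace_mulC mulmxA (mulmx1C PP) mul1mx.
  by rewrite trace_map_mx.
- apply: complexI; rewrite [RHS]rmorph_sum/=.
  transitivity (\tr (map_mx (real_complex R) (A *m M))).
    by rewrite trace_map_mx.
  rewrite map_mxM AE -/Mc.
  rewrite -!mulmxA mxtrace_mulC.
  have -> : diag_mx (\row_i (D i)%:C) *m (P *m Mc) *m P^t* = diag_mx (\row_i (D i)%:C) *m N.
    by rewrite /N !mulmxA.
  rewrite /mxtrace; apply: eq_bigr => i _.
  by rewrite mul_diag_mx mxE [(\row_j _) _ _]mxE -wE -rmorphM.
Qed.

Hypothesis (D0 : forall i, D i != 0).

(** With at most two positive eigenvalues, some nonzero vector of the row space has no component
    along their eigenvectors. The form is then both nonnegative and nonpositive on it, and as no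
    eigenvalue is 0 the vector vanishes. *)
Lemma inertia_ge3 (W : 'M[R]_(3, n)) : row_free W ->
  (forall c : 'rV[R]_3, 0 <= (c *m W *m A *m (c *m W)^T) 0 0) ->
  (2 < #|[set i | (0 < D i)%R]|)%N.
Proof.
move=> Wfree Wge0; rewrite ltnNge; apply/negP => S2.
set S := [set i | _] in S2.
set Wc := map_mx (real_complex R) W.
have Wcfree : row_free Wc by rewrite row_free_map.
pose Y := Wc *m P^t*.
pose Y' := colsub (fun k : 'I_#|S| => enum_val k) Y.
have /rowV0Pn[c cK c0] : kermx Y' != 0.
  rewrite -mxrank_eq0 mxrank_ker subn_eq0 -ltnNge.
  by apply: leq_ltn_trans (rank_leq_col _) _; rewrite ltnS.
pose y := c *m Y.
have yS i : i \in S -> y 0 i = 0.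
  move=> iS; have /sub_kermxP/matrixP/(_ 0 (enum_rank_in iS i)) := cK.
  rewrite mxE [RHS]mxE => <-; rewrite mxE; apply: eq_bigr => j _.
  by rewrite !mxE enum_rankK_in.
pose x := c *m Wc.
have yx : y = x *m P^t* by rewrite /y /x mulmxA.
have xE : x = y *m P by rewrite yx -mulmxA (mulmx1C PP) mulmx1.
pose a := map_mx (@complex.Re R) c; pose b := map_mx (@complex.Im R) c.
have ReX j : complex.Re (x 0 j) = (a *m W) 0 j.
  rewrite !mxE raddf_sum; apply: eq_bigr => k _; rewrite !mxE.
  by case: (c 0 k) => u v /=; rewrite mulr0 subr0.
have ImX j : complex.Im (x 0 j) = (b *m W) 0 j.
  rewrite !mxE raddf_sum; apply: eq_bigr => k _; rewrite !mxE.
  by case: (c 0 k) => u v /=; rewrite mulr0 add0r.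
(* [c] is complex while [Wge0] concerns real vectors; as [A] is real, the form splits into its
   values at the real and imaginary parts. *)
have form : complex.Re ((x *m map_mx (real_complex R) A *m x^t*) 0 0) =
   (a *m W *m A *m (a *m W)^T) 0 0 + (b *m W *m A *m (b *m W)^T) 0 0.
  rewrite mxE [in RHS]mxE [X in _ + X]mxE raddf_sum -big_split/=.
  apply: eq_bigr => j _.
  rewrite [(_ *m A) 0 j]mxE [X in _ + X * _]mxE [(x *m _) 0 j]mxE.
  rewrite !mulr_suml raddf_sum -big_split/=; apply: eq_bigr => k _.
  rewrite ![_^T _ _]mxE [_^t* _ _]mxE [_^T _ _]mxE [map_mx _ _ _ _]mxE -!ReX -!ImX.
  case: (x 0 k) => u v; case: (x 0 j) => u' v' /=; ring.
have : 0 <= complex.Re ((x *m map_mx (real_complex R) A *m x^t*) 0 0).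
  by rewrite form addr_ge0.
rewrite AE xE.
have -> : y *m P *m (P^t* *m diag_mx (\row_i (D i)%:C) *m P) *m (y *m P)^t*
   = y *m diag_mx (\row_i (D i)%:C) *m y^t*.
  by rewrite trmx_mul map_mxM !mulmxA -[_ *m P *m P^t*]mulmxA PP mulmx1
    -[_ *m P *m P^t*]mulmxA PP mulmx1.
have -> : (y *m diag_mx (\row_i (D i)%:C) *m y^t*) 0 0 =
    (\sum_i D i * (complex.Re (y 0 i) ^+ 2 + complex.Im (y 0 i) ^+ 2))%:C.
  rewrite mxE rmorph_sum; apply: eq_bigr => i _.
  rewrite mul_mx_diag !mxE rmorphM/= add_Re2_Im2 normCK; ring.
rewrite /= => sum_ge0.
have term_le0 i : D i * (complex.Re (y 0 i) ^+ 2 + complex.Im (y 0 i) ^+ 2) <= 0.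
  have [iS|] := boolP (i \in S); first by rewrite yS//= expr0n/= addr0 mulr0.
  rewrite inE -leNgt => Di; rewrite mulr_le0_ge0//.
  by rewrite addr_ge0 ?sqr_ge0.
have y0 : y = 0.
  apply/rowP => i; rewrite [RHS]mxE.
  have : \sum_i - (D i * (complex.Re (y 0 i) ^+ 2 + complex.Im (y 0 i) ^+ 2)) == 0.
    rewrite eq_le; apply/andP; split; first by rewrite sumrN oppr_le0.
    by apply: sumr_ge0 => j _; rewrite oppr_ge0.
  rewrite psumr_eq0; last by move=> j _; rewrite oppr_ge0.
  move=> /allP/(_ i (mem_index_enum _)); rewrite /= oppr_eq0 mulf_eq0 (negPf (D0 i))/=.
  rewrite paddr_eq0 ?sqr_ge0// !sqrf_eq0 => /andP[/eqP r /eqP m].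
  by apply/eqP; rewrite eq_complex; apply/andP; split; apply/eqP; [exact: r | exact: m].
have : x == 0 by rewrite xE y0 mul0mx.
by rewrite /x mulmx_free_eq0// (negPf c0).
Qed.

End Diagonalized.

End Spectral.

(** * Adjacency form and energy *)

Definition qform (R : realType) (G : sgraph) (f : G -> R) : R :=
  \sum_x \sum_y f x * f y * (adjacent x y)%:R.

Definition vrow (R : realType) (G : sgraph) (f : G -> R) : 'rV[R]_#|G| :=
  \row_i f (enum_val i).

Lemma sum_vertex (R : realType) (G : sgraph) (F : G -> R) :
  \sum_x F x = \sum_(i < #|G|) F (enum_val i).
Proof. exact: big_enum_val. Qed.

Lemma qform_vrow (R : realType) (G : sgraph) (f : G -> R) :
  (vrow f *m adjmx R G *m (vrow f)^T) 0 0 = qform f.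
Proof.
rewrite /qform sum_vertex mxE exchange_big/= sum_vertex; apply: eq_bigr => j _.
rewrite mxE mulr_suml; apply: eq_bigr => i _; rewrite !mxE; ring.
Qed.

Lemma vrow_dot (R : realType) (G : sgraph) (f g : G -> R) :
  vrow f *m (vrow g)^T = (\sum_x f x * g x)%:M.
Proof.
apply/matrixP => i j; rewrite !ord1 !mxE eqxx mulr1n sum_vertex.
by apply: eq_bigr => k _; rewrite !mxE.
Qed.

Lemma adjmx_sym (R : realType) (G : sgraph) : (adjmx R G)^T = adjmx R G.
Proof. by apply/matrixP => i j; rewrite !mxE adjacent_sym. Qed.

Lemma trace_adjmx (R : realType) (G : sgraph) : \tr (adjmx R G) = 0.
Proof. by rewrite /mxtrace big1// => i _; rewrite mxE adjacent_irrefl. Qed.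

(** Ordered adjacent pairs are counted in two ways: by first vertex, and by underlying edge, each
    edge having exactly two orderings. *)
Lemma card_edges2 (G : sgraph) : (2 * #|edges G| = \sum_(x : G) degree x)%N.
Proof.
have -> : (\sum_(x : G) degree x)%N = #|[set u : G * G | adjacent u.1 u.2]|.
  rewrite -sum1_card (eq_bigl (fun u : G * G => adjacent u.1 u.2)); last first.
    by move=> u; rewrite inE.
  rewrite -(pair_big_dep xpredT (fun x y => adjacent x y) (fun _ _ => 1%N))/=.
  apply: eq_bigr => x _; rewrite /degree -sum1_card.
  by apply: eq_bigl => y; rewrite inE.
pose h (u : G * G) := [set u.1; u.2].
rewrite -[RHS]sum1_card (partition_big h (mem (edges G)))/=; last first.
  by move=> u; rewrite inE => uadj; apply/imsetP; exists u; rewrite ?inE.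
rewrite mulnC -sum_nat_const; apply: eq_bigr => X /imsetP[[a b]].
rewrite inE/= => ab ->; rewrite sum1_card.
have anb : a != b by apply: contraTneq ab => ->; rewrite adjacent_irrefl.
have -> : 2%N = #|[set (a, b); (b, a)]| by rewrite cards2 xpair_eqE negb_and anb.
apply: eq_card => -[c e]; rewrite !inE/= /h/=.
apply/orP/andP => [[]/eqP[-> ->]|[ce /eqP he]].
- by rewrite inE/= ab eqxx.
- by rewrite inE/= adjacent_sym ab setUC eqxx.
have cne : c != e by move: ce; rewrite inE/=; apply: contraTneq => ->; rewrite adjacent_irrefl.
have : c \in [set a; b] by rewrite -he !inE eqxx.
have : e \in [set a; b] by rewrite -he !inE eqxx orbT.
rewrite !inE => /orP[]/eqP eE /orP[]/eqP cE; subst; rewrite ?eqxx// in cne *; auto.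
Qed.

Lemma sum_degree (R : realType) (G : sgraph) :
  \sum_(x : G) \sum_(y : G) (adjacent x y)%:R = (2 * #|edges G|)%:R :> R.
Proof.
rewrite card_edges2 natr_sum; apply: eq_bigr => x _.
rewrite /degree -sum1_card natr_sum.
rewrite [RHS](eq_bigl (fun y => adjacent x y)); last by move=> y; rewrite inE.
by rewrite [RHS]big_mkcond; apply: eq_bigr => y _; case: adjacent.
Qed.

Lemma avg_degreeE (R : realType) (G : sgraph) : (0 < #|G|)%N ->
  #|G|%:R * avg_degree R G = (2 * #|edges G|)%:R.
Proof.
by move=> n0; rewrite /avg_degree mulrCA divff ?mulr1// pnatr_eq0 -lt0n.
Qed.

Lemma sum_sqr1 (R : realType) (G : sgraph) : \sum_(x : G) (1 : R) ^+ 2 = #|G|%:R.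
Proof. by rewrite expr1n sumr_const. Qed.

Lemma qform1 (R : realType) (G : sgraph) : (0 < #|G|)%N ->
  @qform R G (fun=> 1) = #|G|%:R * avg_degree R G.
Proof.
move=> n0; rewrite avg_degreeE// -sum_degree.
by apply: eq_bigr => x _; apply: eq_bigr => y _; rewrite !mul1r.
Qed.

Lemma trace_sqr_adjmx (R : realType) (G : sgraph) :
  \tr (adjmx R G *m adjmx R G) = (2 * #|edges G|)%:R.
Proof.
rewrite -sum_degree sum_vertex; apply: eq_bigr => i _.
rewrite mxE sum_vertex; apply: eq_bigr => j _.
by rewrite !mxE [adjacent (enum_val j) _]adjacent_sym; case: adjacent; rewrite ?mulr1 ?mulr0.
Qed.

(** The diagonal [D] and the list [eigenvalues] are the roots of the same split polynomial, hence
    agree up to order, which the energy ignores. *)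
Lemma spectrum_exists (R : realType) (G : sgraph) :
  exists (P : 'M[R[i]]_#|G|) (D : 'I_#|G| -> R), [/\ P \is unitarymx,
    map_mx (real_complex R) (adjmx R G)
      = (P ^t* *m diag_mx (\row_i (D i)%:C%C) *m P)%sesqui
    & energy R G = \sum_i `|D i|].
Proof.
have [P [D [Pu AE]]] := @real_sym_spectral R _ _ (adjmx_sym R G).
exists P, D; split=> //.
have pe : perm_eq (eigenvalues R G) [seq D i | i <- enum 'I_#|G|].
  apply: prod_XsubC_eq; rewrite -char_poly_eigenvalues big_map big_enum/=.
  exact: char_poly_spectral Pu AE.
by rewrite /energy (perm_big _ pe)/= big_map big_enum.
Qed.

(** Since the trace is 0, the energy is twice the sum of the positive eigenvalues, and weights
    between 0 and 1 cannot exceed that sum. *)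
Lemma energy_ge_trace (R : realType) (G : sgraph) (M : 'M[R]_#|G|) :
  M^T = M -> M *m M = M -> 2 * \tr (adjmx R G *m M) <= energy R G.
Proof.
move=> Msym Midem; have [P [D [Pu AE ->]]] := spectrum_exists R G.
have [w [w01 _ ->]] := proj_weights Pu AE Msym Midem.
have D0 : \sum_i D i = 0 by rewrite -(trace_spectral Pu AE) trace_adjmx.
have -> : \sum_i `|D i| = \sum_i (`|D i| + D i) by rewrite big_split/= D0 addr0.
rewrite mulr_sumr; apply: ler_sum => i _.
have /andP[w0 w1] := w01 i.
by have [Di|Di] := ler0P (D i); nra.
Qed.

(** * Energy bounds from test vectors *)

Lemma qform_rank1 (R : realType) (G : sgraph) (f : G -> R) :
  \tr (adjmx R G *m ((vrow f)^T *m vrow f)) = qform f.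
Proof. by rewrite mulmxA mxtrace_mulC mulmxA -qform_vrow /mxtrace big_ord1. Qed.

Definition line_proj (R : realType) (G : sgraph) (f : G -> R) : 'M[R]_#|G| :=
  (\sum_x f x ^+ 2)^-1 *: ((vrow f)^T *m vrow f).

Lemma line_proj_sym (R : realType) (G : sgraph) (f : G -> R) :
  (line_proj f)^T = line_proj f.
Proof. by rewrite linearZ/= trmx_mul trmxK. Qed.

Lemma line_proj_mul (R : realType) (G : sgraph) (f g : G -> R) :
  line_proj f *m line_proj g = ((\sum_x f x ^+ 2)^-1 * (\sum_x g x ^+ 2)^-1
    * \sum_x f x * g x) *: ((vrow f)^T *m vrow g).
Proof.
rewrite -scalemxAl -scalemxAr mulmxA -[_ *m vrow f *m _]mulmxA vrow_dot.
rewrite scalar_mxC mul_scalar_mx -scalemxAl !scalerA; congr (_ *: _); ring.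
Qed.

Lemma line_proj_idem (R : realType) (G : sgraph) (f : G -> R) :
  0 < \sum_x f x ^+ 2 -> line_proj f *m line_proj f = line_proj f.
Proof.
move=> f0; rewrite line_proj_mul; congr (_ *: _).
under [X in _ * X]eq_bigr do rewrite -expr2.
by rewrite -mulrA mulVf ?mulr1// gt_eqF.
Qed.

Lemma line_proj_orth (R : realType) (G : sgraph) (f g : G -> R) :
  \sum_x f x * g x = 0 -> line_proj f *m line_proj g = 0.
Proof. by move=> fg; rewrite line_proj_mul fg mulr0 scale0r. Qed.

Lemma trace_adjmx_line_proj (R : realType) (G : sgraph) (f : G -> R) :
  \tr (adjmx R G *m line_proj f) = qform f / \sum_x f x ^+ 2.
Proof. by rewrite -scalemxAr mxtraceZ qform_rank1 mulrC. Qed.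

Lemma energy_ge_qform (R : realType) (G : sgraph) (f : G -> R) :
  0 < \sum_x f x ^+ 2 -> 2 * (qform f / \sum_x f x ^+ 2) <= energy R G.
Proof.
move=> f0; rewrite -trace_adjmx_line_proj; apply: energy_ge_trace.
  exact: line_proj_sym.
exact: line_proj_idem.
Qed.

(** The sum of the projections onto two orthogonal lines is again an orthogonal projection. *)
Lemma energy_ge_qform2 (R : realType) (G : sgraph) (f g : G -> R) :
  0 < \sum_x f x ^+ 2 -> 0 < \sum_x g x ^+ 2 -> \sum_x f x * g x = 0 ->
  2 * (qform f / (\sum_x f x ^+ 2) + qform g / (\sum_x g x ^+ 2)) <= energy R G.
Proof.
move=> f0 g0 fg; rewrite -!trace_adjmx_line_proj -mxtraceD -mulmxDr.
apply: energy_ge_trace; first by rewrite linearD/= !line_proj_sym.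
have gf : \sum_x g x * f x = 0 by under eq_bigr do rewrite mulrC.
by rewrite mulmxDl !mulmxDr !line_proj_idem// !line_proj_orth// addr0 add0r.
Qed.

Lemma det_adjmx_norm_ge1 (R : realType) (G : sgraph) :
  nonsingular R G -> 1 <= `|\det (adjmx R G)|.
Proof.
rewrite /nonsingular unitmxE unitfE.
have -> : adjmx R G = map_mx intr (adjmx int G).
  by apply/matrixP => i j; rewrite !mxE; case: adjacent.
rewrite det_map_mx intr_eq0 -intr_norm ler1z => d0.
by rewrite -gtz0_ge1 normr_gt0.
Qed.

(* For nonsingular [G]: the adjacency matrix has at most two positive
   eigenvalues, phrased as the absence of a 3-dimensional space on which its
   quadratic form is nonnegative. *)
Definition few_positive (R : realType) (G : sgraph) : Prop :=
  forall w : 'I_3 -> G -> R,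
    (forall c : 'I_3 -> R, 0 <= qform (fun x => \sum_k c k * w k x)) ->
    exists2 c : 'I_3 -> R, (exists k, c k != 0) &
      forall x, \sum_k c k * w k x = 0.

Lemma energy_or_few_positive (R : realType) (G : sgraph) : (0 < #|G|)%N ->
  nonsingular R G ->
  #|G|%:R - 1 + avg_degree R G <= energy R G \/
  few_positive R G.
Proof.
move=> n0 nsG; have [P [D [Pu AE ->]]] := spectrum_exists R G.
have detD := det_spectral Pu AE.
have det1 := det_adjmx_norm_ge1 nsG.
have D0 i : D i != 0.
  apply: contraTneq det1 => Di0.
  by rewrite detD (bigD1 i)//= Di0 mul0r normr0 ler10.
have [S3|S2] := boolP (2 < #|[set i | (0 < D i)%R]|)%N; last first.
  right=> w wge0; pose W := \matrix_(k < 3, i < #|G|) w k (enum_val i).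
  have comb (c : 'rV[R]_3) : c *m W = vrow (fun x => \sum_k c 0 k * w k x).
    by apply/rowP => i; rewrite !mxE; apply: eq_bigr => k _; rewrite mxE.
  have : ~~ row_free W.
    apply: contra S2 => Wfree; apply: (inertia_ge3 Pu AE D0 Wfree) => c.
    by rewrite comb qform_vrow wge0.
  rewrite -kermx_eq0 => /rowV0Pn[c /sub_kermxP cW c0].
  have [k ck] : exists k, c 0 k != 0.
    by apply/existsP; apply: contraNT c0 => /existsPn h; apply/eqP/rowP => k;
      rewrite mxE; apply/eqP; move: (h k); rewrite negbK.
  exists (c 0); first by exists k.
  move=> x; have /rowP/(_ (enum_rank x)) : vrow (fun x => \sum_k c 0 k * w k x) = 0.
    by rewrite -comb.
  by rewrite !mxE enum_rankK.
left; pose j0 := Ordinal n0.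
case: (@arg_maxP _ _ _ j0 xpredT D isT) => i0 _ maxi.
have [p1 /[!inE] p1P] : exists p, p \in [set i | (0 < D i)%R].
  by apply/set0Pn; rewrite -card_gt0; apply: leq_trans S3.
have Di0 : 0 < D i0 := lt_le_trans p1P (maxi p1 isT).
have S1 : (1 < #|[set i | (0 < D i)%R] :\ i0|)%N.
  by move: S3; rewrite (cardsD1 i0) inE Di0.
have /card_gt1P[q1 [q2 [q1P q2P q12]]] := S1.
have dE := avg_degreeE R n0.
rewrite -[X in X%:R - 1 + _](card_ord #|G|).
apply: (@core_bound R 'I_#|G| D (avg_degree R G) i0 D0 Di0 _ _ _ _ q1 q2 _ _ q12).
(* The largest eigenvalue is at least the average degree: projecting onto the all-ones vector
   exhibits the latter as a convex combination of eigenvalues. *)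
- have n0R : 0 < #|G|%:R :> R by rewrite ltr0n.
  have one0 : 0 < \sum_(x : G) (1 : R) ^+ 2 by rewrite sum_sqr1.
  have [w [w01 sw tw]] :=
    proj_weights Pu AE (line_proj_sym (fun=> 1)) (line_proj_idem one0).
  have trM : \tr (@line_proj R G (fun=> 1)) = 1.
    rewrite mxtraceZ mxtrace_mulC vrow_dot mxtrace_scalar mulr1n.
    under [X in _ * X]eq_bigr do rewrite -expr2.
    by rewrite mulVf// gt_eqF.
  have trAM : \tr (adjmx R G *m @line_proj R G (fun=> 1)) = avg_degree R G.
    by rewrite trace_adjmx_line_proj qform1// sum_sqr1 mulrAC divff ?mul1r ?gt_eqF.
  rewrite -trAM tw -[leRHS]mulr1 -trM -sw mulr_sumr; apply: ler_sum => i _.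
  by apply: ler_wpM2r; [case/andP: (w01 i) | exact: maxi].
- by rewrite -(trace_spectral Pu AE) trace_adjmx.
- by rewrite -(trace_sqr_spectral Pu AE) trace_sqr_adjmx card_ord dE.
- rewrite -[0 <= _]ler_expR expR0 expR_sum.
  rewrite (eq_bigr (fun i => `|D i|)); first by rewrite -normr_prod -detD.
  by move=> i _; rewrite lnK ?posrE ?normr_gt0.
- by move: q1P; rewrite !inE.
- by move: q2P; rewrite !inE.
Qed.

(** * The complement when there are at most two positive eigenvalues *)

Lemma qform_delta (R : realType) (G : sgraph) (m : nat) (v : 'I_m -> G) (u : 'I_m -> R) :
  qform (fun x => \sum_j u j * (x == v j)%:R) =
  \sum_j \sum_l u j * u l * (adjacent (v j) (v l))%:R.
Proof.
have pick (F : G -> R) j : \sum_x (x == v j)%:R * F x = F (v j).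
  rewrite (bigD1 (v j))//= eqxx mul1r big1 ?addr0// => x /negPf->.
  by rewrite mul0r.
rewrite /qform.
transitivity (\sum_x \sum_j (x == v j)%:R * (u j * \sum_y \sum_l (y == v l)%:R * (u l * (adjacent x y)%:R))).
  apply: eq_bigr => x _; rewrite [RHS](eq_bigr (fun j => (u j * (x == v j)%:R) *
     \sum_y \sum_l (y == v l)%:R * (u l * (adjacent x y)%:R))); last first.
    by move=> j _; ring.
  rewrite -mulr_suml mulr_sumr; apply: eq_bigr => y _.
  rewrite -mulrA; congr (_ * _); rewrite mulr_suml; apply: eq_bigr => l _; ring.
rewrite exchange_big; apply: eq_bigr => j _; rewrite (pick (fun x => _)).
rewrite exchange_big mulr_sumr; apply: eq_bigr => l _.
by rewrite (pick (fun y => _)); ring.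
Qed.

(** Extending the rows of [M] by zero outside the vertices [v] turns [few_positive] into a statement
    about a small induced subgraph. *)
Lemma few_positive_sub (R : realType) (G : sgraph) (m : nat) (v : 'I_m -> G)
    (M : 'I_3 -> 'I_m -> R) : few_positive R G -> injective v ->
  (forall c : 'I_3 -> R, 0 <= \sum_j \sum_l (\sum_k c k * M k j) *
      (\sum_k c k * M k l) * (adjacent (v j) (v l))%:R) ->
  exists2 c : 'I_3 -> R, (exists k, c k != 0) & forall j, \sum_k c k * M k j = 0.
Proof.
move=> few vinj ge0.
have comb c x : \sum_k c k * (\sum_j M k j * (x == v j)%:R) =
    \sum_j (\sum_k c k * M k j) * (x == v j)%:R.
  under eq_bigr do rewrite mulr_sumr.
  rewrite exchange_big; apply: eq_bigr => j _.
  by rewrite mulr_suml; apply: eq_bigr => k _; rewrite mulrA.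
have [|c c0 cw] := few (fun k x => \sum_j M k j * (x == v j)%:R).
  move=> c; rewrite (_ : qform _ = qform (fun x => \sum_j (\sum_k c k * M k j) * (x == v j)%:R)).
    by rewrite qform_delta; exact: ge0.
  by apply: eq_bigr => x _; apply: eq_bigr => y _; rewrite !comb.
exists c => // j; move: (cw (v j)); rewrite comb (bigD1 j)//= eqxx mulr1 [X in _ + X]big1 ?addr0//.
by move=> l lj; rewrite (inj_eq vinj) eq_sym (negPf lj) mulr0.
Qed.

(** Adjacency in the complement [H] of [G]. *)
Definition nadj (G : sgraph) (x y : G) := (x != y) && ~~ adjacent x y.

Lemma nadjC (G : sgraph) (x y : G) : nadj x y = nadj y x.
Proof. by rewrite /nadj eq_sym adjacent_sym. Qed.

Lemma adjacentE (G : sgraph) (x y : G) : x != y -> adjacent x y = ~~ nadj x y.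
Proof. by rewrite /nadj => ->; rewrite negbK. Qed.

Definition seqfun (T : Type) (x0 : T) (s : seq T) (m : nat) (i : 'I_m) := nth x0 s i.

Lemma seqfun_inj (T : eqType) (x0 : T) (s : seq T) (m : nat) :
  size s = m -> uniq s -> injective (@seqfun T x0 s m).
Proof.
move=> <- us i j /eqP; rewrite /seqfun nth_uniq ?ltn_ord// => /eqP ij.
exact: val_inj.
Qed.

Definition seqmx (R : realType) (s : seq (seq R)) (m : nat) (k : 'I_3) (j : 'I_m) : R :=
  nth 0 (nth [::] s k) j.

Lemma ord3_eq0 (R : realType) (u : 'I_3 -> R) (k : 'I_3) : u ord0 = 0 ->
  u (lift ord0 ord0) = 0 -> u (lift ord0 (lift ord0 ord0)) = 0 -> u k = 0.
Proof.
move=> u0 u1 u2; case: k => -[|[|[|//]]] i.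
- by rewrite -[RHS]u0; congr u; exact: val_inj.
- by rewrite -[RHS]u1; congr u; exact: val_inj.
- by rewrite -[RHS]u2; congr u; exact: val_inj.
Qed.

Section FewPositive.
Variables (R : realType) (G : sgraph).
Hypothesis few : few_positive R G.

(** A triangle of [H] is an independent triple of [G], and the form vanishes on vectors supported
    there. *)
Lemma nadj_triangle_free (a b c : G) : nadj a b -> nadj b c -> nadj a c -> False.
Proof.
move=> /andP[ab nab] /andP[bc nbc] /andP[ac nac].
have [||u [k uk]] := @few_positive_sub R G 3 (@seqfun _ a [:: a; b; c] _)
  (@seqmx R [:: [:: 1; 0; 0]; [:: 0; 1; 0]; [:: 0; 0; 1]] _) few.
- by apply: seqfun_inj => //=; rewrite !inE negb_or ab ac bc.
- move=> u; rewrite /seqfun /seqmx !big_ord_recl !big_ord0 /= !adjacent_irrefl.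
  rewrite ![adjacent b a]adjacent_sym ![adjacent c _]adjacent_sym.
  by rewrite (negPf nab) (negPf nac) (negPf nbc) !mulr0 !addr0.
move=> h; move: (h 0) (h 1) (h 2).
rewrite /seqmx !big_ord_recl !big_ord0 /= => h0 h1 h2.
by case/eqP: uk; apply: ord3_eq0; lra.
Qed.

(** Such vertices induce a 4-cycle in [G]; the test vectors are a basis of its kernel and the
    constant vector, which belongs to the eigenvalue 2. *)
Lemma nadj_2K2_free (a b c d : G) : nadj a b -> nadj c d ->
  ~~ nadj a c -> ~~ nadj a d -> ~~ nadj b c -> ~~ nadj b d -> False.
Proof.
move=> ab cd ac ad bc bd.
have nac : a != c by apply: contraNneq ad => ->.
have nad : a != d by apply: contraNneq ac => ->; rewrite nadjC.
have nbc : b != c by apply: contraNneq bd => ->.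
have nbd : b != d by apply: contraNneq bc => ->; rewrite nadjC.
have aac : adjacent a c by rewrite adjacentE.
have aad : adjacent a d by rewrite adjacentE.
have abc : adjacent b c by rewrite adjacentE.
have abd : adjacent b d by rewrite adjacentE.
case/andP: ab cd => ab nab /andP[cd ncd].
have [||u [k uk]] := @few_positive_sub R G 4 (@seqfun _ a [:: a; b; c; d] _)
  (@seqmx R [:: [:: 1; -1; 0; 0]; [:: 0; 0; 1; -1]; [:: 1; 1; 1; 1]] _) few.
- by apply: seqfun_inj => //=; rewrite !inE !negb_or ab nac nad nbc nbd cd.
- move=> u; rewrite /seqfun /seqmx !big_ord_recl !big_ord0 /= !adjacent_irrefl.
  rewrite ![adjacent b a]adjacent_sym ![adjacent c a]adjacent_sym ![adjacent d a]adjacent_sym.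
  rewrite ![adjacent c b]adjacent_sym ![adjacent d b]adjacent_sym ![adjacent d c]adjacent_sym.
  rewrite (negPf nab) (negPf ncd) aac aad abc abd /=.
  by have := sqr_ge0 (u (lift ord0 (lift ord0 ord0))); lra.
move=> h; move: (h 0) (h 1) (h 2) (h 3).
rewrite /seqmx !big_ord_recl !big_ord0 /= => h0 h1 h2 h3.
by case/eqP: uk; apply: ord3_eq0; lra.
Qed.

Lemma nadj_C5_free (a b c d e : G) :
  nadj a b -> nadj b c -> nadj c d -> nadj d e -> nadj e a ->
  ~~ nadj a c -> ~~ nadj b d -> ~~ nadj c e -> ~~ nadj d a -> ~~ nadj e b -> False.
Proof.
move=> ab bc cd de ea ac bd ce da eb.
have nac : a != c by apply: contraNneq da => ->; rewrite nadjC.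
have nbd : b != d by apply: contraNneq eb => ->; rewrite nadjC.
have nce : c != e by apply: contraNneq ac => ->; rewrite nadjC.
have nda : d != a by apply: contraNneq bd => ->; rewrite nadjC.
have neb : e != b by apply: contraNneq ce => ->; rewrite nadjC.
have aac : adjacent a c by rewrite adjacentE.
have abd : adjacent b d by rewrite adjacentE.
have ace : adjacent c e by rewrite adjacentE.
have ada : adjacent a d by rewrite adjacent_sym adjacentE.
have aeb : adjacent b e by rewrite adjacent_sym adjacentE.
case/andP: ab bc cd de ea => ab nab /andP[bc nbc] /andP[cd ncd] /andP[de nde] /andP[ea nea].
rewrite adjacent_sym in nea.
(* A 5-cycle is self-complementary: along the cycle a, c, e, b, d of [G] the rows
   are the constant vector and integer approximations of the eigenvectors for
   the double eigenvalue 2 cos (2 pi / 5) > 0. *)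
have [||u [k uk]] := @few_positive_sub R G 5 (@seqfun _ a [:: a; c; e; b; d] _)
  (@seqmx R [:: [:: 1; 1; 1; 1; 1]; [:: 2; 1; -2; -2; 1]; [:: 0; 3; 2; -2; -3]] _) few.
- apply: seqfun_inj => //=; rewrite !inE !negb_or nac [a == e]eq_sym ea ab [a == d]eq_sym nda.
  by rewrite nce [c == b]eq_sym bc cd neb [e == d]eq_sym de nbd.
- move=> u; rewrite /seqfun /seqmx !big_ord_recl !big_ord0 /= !adjacent_irrefl.
  rewrite ![adjacent b a]adjacent_sym ![adjacent c a]adjacent_sym ![adjacent d a]adjacent_sym
    ![adjacent e a]adjacent_sym.
  rewrite ![adjacent c b]adjacent_sym ![adjacent d b]adjacent_sym ![adjacent e b]adjacent_sym
    ![adjacent d c]adjacent_sym ![adjacent e c]adjacent_sym ![adjacent e d]adjacent_sym.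
  rewrite (negPf nab) (negPf nbc) (negPf ncd) (negPf nde) (negPf nea) aac abd ace ada aeb /=.
  (* The three rows are orthogonal for the form, which equals [10 u0^2 + 8 u1^2 + 16 u2^2]. *)
  have := sqr_ge0 (u (lift ord0 (lift ord0 ord0))).
  have := sqr_ge0 (u (lift ord0 ord0)); have := sqr_ge0 (u ord0); lra.
move=> h; move: (h 0) (h 1) (h 2) (h 3) (h 4).
rewrite /seqmx !big_ord_recl !big_ord0 /= => h0 h1 h2 h3 h4.
by case/eqP: uk; apply: ord3_eq0; lra.
Qed.

End FewPositive.

(** * Neighbourhoods and quadratic form of the complement *)

Definition nnbr (G : sgraph) (x : G) : {set G} := [set y | nadj x y].

Definition nform (R : realType) (G : sgraph) (f : G -> R) : R :=
  \sum_x f x * \sum_(y in nnbr x) f y.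

(** The adjacency matrix of [G] is the all-ones matrix minus the identity minus the adjacency matrix
    of [H], whose form is [nform]. *)
Lemma qform_nform (R : realType) (G : sgraph) (f : G -> R) :
  qform f = (\sum_x f x) ^+ 2 - \sum_x f x ^+ 2 - nform f.
Proof.
rewrite expr2 mulr_suml -sumrB -sumrB; apply: eq_bigr => x _.
rewrite expr2 -!mulrBr.
transitivity (f x * \sum_y f y * (adjacent x y)%:R).
  by rewrite mulr_sumr; apply: eq_bigr => y _; rewrite mulrA.
congr (_ * _).
have -> : \sum_y f y = f x + \sum_(y | y != x) f y by rewrite (bigD1 x).
rewrite [f x + _]addrC addrK.
rewrite [in RHS]big_mkcond [X in _ - X]big_mkcond -sumrB/=; apply: eq_bigr => y _.
rewrite inE /nadj eq_sym; have [->|_] /= := eqVneq x y.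
  by rewrite adjacent_irrefl mulr0 subrr.
by case: adjacent; rewrite /= ?mulr1 ?mulr0 ?subr0 ?subrr.
Qed.

Lemma card_nnbr_degree (G : sgraph) (x : G) : (degree x + #|nnbr x| + 1 = #|G|)%N.
Proof.
rewrite /degree -cardsUI (_ : _ :&: _ = set0); last first.
  by apply/setP => y; rewrite !inE /nadj; case: adjacent; rewrite ?andbF.
rewrite cards0 addn0 (_ : _ :|: _ = [set~ x]); last first.
  apply/setP => y; rewrite !inE /nadj eq_sym; case: eqVneq => [->|_] /=.
    by rewrite adjacent_irrefl.
  by case: adjacent.
by rewrite cardsC1 addn1 prednK//; apply/card_gt0P; exists x.
Qed.

Lemma sum_card_nnbr (G : sgraph) :
  (2 * #|edges G| + \sum_(x : G) #|nnbr x| + #|G| = #|G| * #|G|)%N.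
Proof.
rewrite card_edges2 -[X in (_ + X = _)%N]muln1 -[X in (X * 1)%N]sum1_card big_distrl/=.
rewrite -!big_split/= -[RHS]sum_nat_const; apply: eq_bigr => x _.
exact: card_nnbr_degree.
Qed.

Lemma avg_degree_nnbr (R : realType) (G : sgraph) : (0 < #|G|)%N ->
  #|G|%:R * avg_degree R G = #|G|%:R ^+ 2 - #|G|%:R - (\sum_(x : G) #|nnbr x|)%:R.
Proof.
move=> n0; rewrite avg_degreeE// expr2 -natrM -sum_card_nnbr !natrD; ring.
Qed.

Section FewPositive.
Variables (R : realType) (G : sgraph).
Hypothesis few : few_positive R G.
Variables (p q : vertex G).
Hypothesis maxp : forall x : G, (#|nnbr x| <= #|nnbr p|)%N.
Hypothesis pq : nadj p q.
Hypothesis maxq : forall x : G, nadj p x -> (#|nnbr x| <= #|nnbr q|)%N.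

Let T := nnbr p.
Let S := nnbr q.

Lemma mem_T x : (x \in T) = nadj p x. Proof. by rewrite inE. Qed.
Lemma mem_S x : (x \in S) = nadj q x. Proof. by rewrite inE. Qed.

Lemma disjoint_ST x : x \in S -> x \in T -> False.
Proof.
rewrite mem_S mem_T => qx px.
exact: (nadj_triangle_free few pq qx px).
Qed.

Lemma independent_S x y : x \in S -> y \in S -> nadj x y -> False.
Proof. rewrite !mem_S => qx qy xy; exact: (nadj_triangle_free few qx xy qy). Qed.

Lemma independent_T x y : x \in T -> y \in T -> nadj x y -> False.
Proof. rewrite !mem_T => px py xy; exact: (nadj_triangle_free few px xy py). Qed.

(** Otherwise the neighbourhood of [x] in [H] would lie inside that of [y], which is no larger; both
    would coincide, against [z]. *)
Lemma nnbr_diff (x y z : G) : (#|nnbr y| <= #|nnbr x|)%N -> nadj y z -> ~~ nadj x z ->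
  exists2 t, nadj x t & ~~ nadj y t.
Proof.
move=> yx yz nxz; have : ~~ (nnbr x \subset nnbr y).
  apply/negP => sub; have : nnbr x = nnbr y by apply/eqP; rewrite eqEcard sub.
  by move=> /setP/(_ z); rewrite !inE yz (negPf nxz).
by case/subsetPn => t; rewrite !inE => xt yt; exists t.
Qed.

(** Suppose [z] is [H]-adjacent to neither [p] nor [q]. If [w] is [H]-adjacent to one of them,
    maximality yields a neighbour [t] of the other one that [w] misses; then either [zt] is missing
    and two disjoint edges are induced, or an induced 5-cycle closes up. If [w] is adjacent to
    neither, [zw] and [pq] are the two disjoint edges. *)
Lemma nonisolated_ST z w : nadj z w -> (z \in S) || (z \in T).
Proof.
move=> zw; rewrite mem_S mem_T; apply: contraT; rewrite negb_or => /andP[qz pz].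
have [pw|npw] := boolP (nadj p w).
  have [|t qt wt] := @nnbr_diff q w z (maxq pw) _ qz; first by rewrite nadjC.
  have zt : nadj z t.
    apply: contraT => nzt; exfalso.
    apply: (@nadj_2K2_free _ _ few w z q t); rewrite ?[nadj w z]nadjC//.
    - apply/negP => wq; apply: (@independent_T w q); rewrite ?mem_T//.
    - by rewrite nadjC.
  exfalso; apply: (@nadj_C5_free _ _ few p w z t q); rewrite // 1?nadjC//.
  - by apply/negP => pt; apply: (@disjoint_ST t); rewrite ?mem_S ?mem_T.
  - by apply/negP => wq; apply: (@independent_T w q); rewrite ?mem_T.
have [qw|nqw] := boolP (nadj q w); last first.
  exfalso; apply: (@nadj_2K2_free _ _ few z w p q) => //; by rewrite nadjC.
have [|t pt wt] := @nnbr_diff p w z (maxp w) _ pz; first by rewrite nadjC.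
have zt : nadj z t.
  apply: contraT => nzt; exfalso.
  apply: (@nadj_2K2_free _ _ few w z p t); rewrite ?[nadj w z]nadjC//.
  - by rewrite nadjC.
  - by rewrite nadjC.
exfalso; apply: (@nadj_C5_free _ _ few q w z t p); rewrite // 1?nadjC//.
by apply/negP => qt; apply: (@disjoint_ST t); rewrite ?mem_S ?mem_T.
Qed.

Lemma nadj_bipartite x y : nadj x y -> (x \in S) = (y \in T) /\ (x \in T) = (y \in S)
  /\ (x \in S) = ~~ (x \in T).
Proof.
move=> xy; have yx : nadj y x by rewrite nadjC.
have := nonisolated_ST xy; have := nonisolated_ST yx.
have [xS|nxS] := boolP (x \in S); have [xT|nxT] := boolP (x \in T);
have [yS|nyS] := boolP (y \in S); have [yT|nyT] := boolP (y \in T) => //= _ _; exfalso.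
all: try exact: (disjoint_ST xS xT).
all: try exact: (disjoint_ST yS yT).
all: try exact: (independent_S xS yS xy).
all: exact: (independent_T xT yT xy).
Qed.

End FewPositive.

(** * Bipartite complements *)

Section Bipartite.
Variables (R : realType) (G : sgraph) (p q : vertex G).
Let T := nnbr p.
Let S := nnbr q.
Hypothesis pq : nadj p q.
Hypothesis disjST : forall x : G, x \in S -> x \in T -> False.
Hypothesis bip : forall x y : G, nadj x y ->
  (x \in S) && (y \in T) || (x \in T) && (y \in S).

Let qT : q \in T. Proof. by rewrite inE. Qed.
Let pS : p \in S. Proof. by rewrite inE nadjC. Qed.
Let s_gt0 : (0 < #|S|)%N. Proof. by apply/card_gt0P; exists p. Qed.
Let t_gt0 : (0 < #|T|)%N. Proof. by apply/card_gt0P; exists q. Qed.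
Let n_gt0 : (0 < #|G|)%N. Proof. by apply/card_gt0P; exists p. Qed.

Let pNq : p != q. Proof. by case/andP: pq. Qed.
Let pT : p \in T = false. Proof. by rewrite inE /nadj eqxx. Qed.
Let qS : q \in S = false. Proof. by rewrite inE /nadj eqxx. Qed.

Lemma card_ST_le : (#|S| + #|T| <= #|G|)%N.
Proof.
rewrite -cardsUI (_ : S :&: T = set0) ?cards0 ?addn0 ?max_card//.
by apply/setP => x; rewrite !in_set0 in_setI; apply/negP => /andP[xS xT]; exact: (disjST xS xT).
Qed.

Lemma sum_indicator (A : {set G}) (a : R) : \sum_x a * (x \in A)%:R = a * #|A|%:R.
Proof.
rewrite -mulr_sumr; congr (_ * _); rewrite -sum1_card natr_sum [RHS]big_mkcond/=.
by apply: eq_bigr => x _; case: (x \in A).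
Qed.

Lemma sum_delta (z : G) (a : R) : \sum_x a * (x == z)%:R = a.
Proof.
by rewrite (bigD1 z)//= eqxx mulr1 big1 ?addr0// => x /negPf->; rewrite mulr0.
Qed.

(** The cells are [p], [q], the rest of [T], the rest of [S], and the vertices isolated in [H]; the
    last three have the sizes [a], [b], [i] defined below. *)
Definition cells (a b c d e : R) (x : G) : R :=
  if x == p then a else if x == q then b else
  if x \in T then c else if x \in S then d else e.

Lemma cellsE a b c d e (x : G) : cells a b c d e x =
  e + (a - d) * (x == p)%:R + (b - c) * (x == q)%:R + (c - e) * (x \in T)%:R
    + (d - e) * (x \in S)%:R.
Proof.
rewrite /cells; have [->|xp] := eqVneq x p; first by rewrite pT pS (negPf pNq)/=; ring.
have [->|xq] := eqVneq x q; first by rewrite qT qS/=; ring.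
have [xT|_] := boolP (x \in T); last by case: (x \in S) => /=; ring.
have /negPf-> : x \notin S by apply/negP => xS; exact: (disjST xS xT).
by rewrite /=; ring.
Qed.

Let a : R := #|T|%:R - 1.
Let b : R := #|S|%:R - 1.
Let i : R := #|G|%:R - #|T|%:R - #|S|%:R.

Lemma sum_cells (v1 v2 v3 v4 v5 : R) :
  \sum_x cells v1 v2 v3 v4 v5 x = v1 + v2 + a * v3 + b * v4 + i * v5.
Proof.
under eq_bigr do rewrite cellsE.
rewrite !big_split/= !sum_indicator !sum_delta sumr_const -mulr_natr /a /b /i.
rewrite (_ : #|xpredT| = #|G|)//; ring.
Qed.

Lemma sum_cellsM (v1 v2 v3 v4 v5 w1 w2 w3 w4 w5 : R) :
  \sum_x cells v1 v2 v3 v4 v5 x * cells w1 w2 w3 w4 w5 x =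
  v1 * w1 + v2 * w2 + a * (v3 * w3) + b * (v4 * w4) + i * (v5 * w5).
Proof.
rewrite -sum_cells; apply: eq_bigr => x _; rewrite /cells.
by case: ifP => // _; case: ifP => // _; case: ifP => // _; case: ifP.
Qed.

Lemma sum_cells_sqr (v1 v2 v3 v4 v5 : R) :
  \sum_x cells v1 v2 v3 v4 v5 x ^+ 2 =
  v1 ^+ 2 + v2 ^+ 2 + a * v3 ^+ 2 + b * v4 ^+ 2 + i * v5 ^+ 2.
Proof.
transitivity (\sum_x cells v1 v2 v3 v4 v5 x * cells v1 v2 v3 v4 v5 x).
  by apply: eq_bigr => x _; rewrite expr2.
by rewrite sum_cellsM !expr2.
Qed.

Let E2 : R := (\sum_(x : G) #|nnbr x|)%:R.

(** The all-ones vector contributes twice the average degree, and what is missing to the target is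
    the average degree [E2 / n] of [H], to be supplied by an orthogonal [g]. *)
Lemma energy_ge_avg (g : G -> R) : \sum_x g x = 0 -> 0 < \sum_x g x ^+ 2 ->
  E2 / #|G|%:R <= 2 * (qform g / \sum_x g x ^+ 2) ->
  #|G|%:R - 1 + avg_degree R G <= energy R G.
Proof.
move=> g0 g2 h.
have n0 : 0 < #|G|%:R :> R by rewrite ltr0n.
have := @energy_ge_qform2 R G (fun=> 1) g.
rewrite sum_sqr1 => /(_ n0 g2); under eq_bigr do rewrite mul1r.
move=> /(_ g0); apply: le_trans.
rewrite qform1//.
have dE : avg_degree R G = #|G|%:R - 1 - E2 / #|G|%:R.
  apply: (mulfI (lt0r_neq0 n0)); rewrite avg_degree_nnbr// -/E2; field.
  by rewrite lt0r_neq0.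
rewrite mulrAC divff ?lt0r_neq0// mul1r mulrDr.
have := h; rewrite dE; lra.
Qed.

(** The test vector is [t] on [S], [- s] on [T] and 0 elsewhere. It sums to 0 and every edge of [H]
    joins opposite signs, so its Rayleigh quotient is [(E2 - (s + t)) / (s + t)]. *)
Lemma uniform_bound :
  E2 * (#|S|%:R + #|T|%:R) <= 2 * #|G|%:R * (E2 - (#|S|%:R + #|T|%:R)) ->
  #|G|%:R - 1 + avg_degree R G <= energy R G.
Proof.
move=> h; set s : R := #|S|%:R in h; set t : R := #|T|%:R in h.
have s0 : 0 < s by rewrite ltr0n.
have t0 : 0 < t by rewrite ltr0n.
have n0 : 0 < #|G|%:R :> R by rewrite ltr0n.
have st0 : 0 < s * t * (s + t) by rewrite !mulr_gt0// addr_gt0.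
have sum0 : \sum_x cells t (- s) (- s) t 0 x = 0.
  by rewrite sum_cells /a /b -/s -/t; ring.
have sum2 : \sum_x cells t (- s) (- s) t 0 x ^+ 2 = s * t * (s + t).
  by rewrite sum_cells_sqr /a /b -/s -/t; ring.
have nf : nform (cells t (- s) (- s) t 0) = - (s * t) * E2.
  rewrite /nform /E2 natr_sum mulr_sumr; apply: eq_bigr => x _.
  rewrite mulr_sumr -sum1_card natr_sum mulr_sumr; apply: eq_bigr => y.
  rewrite inE => xy; rewrite mulr1.
  have cT z : z \in T -> cells t (- s) (- s) t 0 z = - s.
    move=> zT; rewrite /cells zT; case: eqVneq => [zp|_]; last by case: ifP.
    by rewrite zp pT in zT.
  have cS z : z \in S -> cells t (- s) (- s) t 0 z = t.
    move=> zS; rewrite /cells; case: eqVneq => // _; case: eqVneq => [zq|_].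
      by rewrite zq qS in zS.
    have /negPf-> : z \notin T by apply/negP => zT; exact: (disjST zS zT).
    by rewrite zS.
  by case/orP: (bip xy) => /andP[hx hy]; [rewrite (cS _ hx) (cT _ hy) | rewrite (cT _ hx) (cS _ hy)]; ring.
apply: (@energy_ge_avg (cells t (- s) (- s) t 0)) => //; first by rewrite sum2.
rewrite qform_nform sum0 sum2 nf.
rewrite [leRHS](_ : _ = 2 * (E2 - (s + t)) / (s + t)); last first.
  by field; rewrite !lt0r_neq0// addr_gt0.
rewrite ler_pdivrMr// mulrAC ler_pdivlMr ?addr_gt0//.
by move: h; rewrite -/s -/t; lra.
Qed.

(** [H] contains the double star joining [p] to [T] and [q] to [S]. Either there is a further edge,
    or every other vertex is a leaf or isolated and [H] is that double star. *)
Lemma tree_dichotomy :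
  (2 * (#|S| + #|T|) <= \sum_(x : G) #|nnbr x|)%N \/
  [/\ (\sum_(x : G) #|nnbr x| + 2 = 2 * (#|S| + #|T|))%N,
      forall x : G, x \in T -> x != q -> nnbr x = [set p] &
      forall x : G, x \in S -> x != p -> nnbr x = [set q]].
Proof.
pose f (x : G) : nat := ((x \in S) + (x \in T))%N.
have sumf : (\sum_x f x = #|S| + #|T|)%N.
  by rewrite /f big_split/= -!sum1_card !(big_mkcond (fun x => _ \in _))/=;
    congr addn; apply: eq_bigr => x _; case: (_ \in _).
have splitpq (F : G -> nat) :
    (\sum_x F x = F p + F q + \sum_(x | (x != p) && (x != q)) F x)%N.
  by rewrite (bigD1 p)//= (bigD1 q)/= ?addnA// eq_sym.
have fp : f p = 1%N by rewrite /f pS pT.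
have fq : f q = 1%N by rewrite /f qS qT.
have f1 x : (f x <= 1)%N.
  rewrite /f; have [xS|] := boolP (x \in S); have [xT|] := boolP (x \in T) => //.
  by case: (disjST xS xT).
have fN x : (f x <= #|nnbr x|)%N.
  have [xST|] := boolP ((x \in S) || (x \in T)); last first.
    by rewrite /f negb_or => /andP[/negPf-> /negPf->].
  apply: leq_trans (f1 x) _; apply/card_gt0P; case/orP: xST; rewrite inE => h.
    by exists q; rewrite inE nadjC.
  by exists p; rewrite inE nadjC.
have Nf x : (#|nnbr x| <= 1)%N -> #|nnbr x| = f x.
  move=> N1; apply/eqP; rewrite eqn_leq fN andbT.
  have [->//|] := posnP #|nnbr x|; move=> /card_gt0P[y]; rewrite inE => /bip xy.
  apply: leq_trans N1 _; rewrite /f.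
  by case/orP: xy => /andP[-> _]; rewrite ?addn1.
have [/existsP[x0 /andP[x0pq N2]]|/existsPn hN] :=
  boolP [exists x, ((x != p) && (x != q)) && (1 < #|nnbr x|)%N].
- left; have lb : (2 * (#|S| + #|T|) <= (\sum_(x : G) #|nnbr x|).+1)%N.
    rewrite mul2n -addnn -{1}sumf !splitpq fp fq -/S -/T.
    rewrite (bigD1 x0)//= [X in (_ <= X.+1)%N](_ : _ = #|T| + #|S| +
       (#|nnbr x0| + \sum_(x | ((x != p) && (x != q)) && (x != x0)) #|nnbr x|))%N; last first.
      by congr addn; rewrite (bigD1 x0).
    have := f1 x0.
    have : (\sum_(x | ((x != p) && (x != q)) && (x != x0)) f x <=
       \sum_(x | ((x != p) && (x != q)) && (x != x0)) #|nnbr x|)%N.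
      by apply: leq_sum => x _; exact: fN.
    by move: N2; lia.
  (* The sum is even by the handshake lemma, which removes the successor. *)
  have := sum_card_nnbr G.
  have : ~~ odd (#|G| * #|G| + #|G|) by rewrite oddD oddM andbb addbb.
  lia.
- right.
  have N1 x : x != p -> x != q -> (#|nnbr x| <= 1)%N.
    by move=> xp xq; have := hN x; rewrite xp xq /= -leqNgt.
  split.
  + rewrite splitpq (eq_bigr f) => [|x /andP[xp xq]]; last exact: Nf (N1 x xp xq).
    by have := sumf; rewrite splitpq fp fq /S /T; lia.
  + move=> x xT xq; have xp : x != p by apply: contraTneq xT => ->; rewrite pT.
    apply/esym/eqP; rewrite eqEcard cards1 N1// andbT sub1set inE nadjC.
    by move: xT; rewrite inE.
  + move=> x xS xp; have xq : x != q by apply: contraTneq xS => ->; rewrite qS.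
    apply/esym/eqP; rewrite eqEcard cards1 N1// andbT sub1set inE nadjC.
    by move: xS; rewrite inE.
Qed.

Lemma nform_cells (v1 v2 v3 v4 v5 : R) :
  (forall x : G, x \in T -> x != q -> nnbr x = [set p]) ->
  (forall x : G, x \in S -> x != p -> nnbr x = [set q]) ->
  nform (cells v1 v2 v3 v4 v5) = 2 * (v1 * v2 + a * (v1 * v3) + b * (v2 * v4)).
Proof.
move=> treeT treeS.
have row x : \sum_(y in nnbr x) cells v1 v2 v3 v4 v5 y =
    cells (v2 + a * v3) (v1 + b * v4) v1 v2 0 x.
  have cp : cells v1 v2 v3 v4 v5 p = v1 by rewrite /cells eqxx.
  have cq : cells v1 v2 v3 v4 v5 q = v2 by rewrite /cells eq_sym (negPf pNq) eqxx.
  rewrite [RHS]/cells; case: eqVneq => [->|xp].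
    rewrite -/T (bigD1 q)//= cq; congr (_ + _).
    rewrite (eq_bigr (fun=> v3)) => [|y /andP[yT yq]].
      rewrite big_const iter_addr_0 -mulr_natl.
      congr (_ * _); rewrite /a (cardsD1 q T) qT natrD addrAC subrr add0r.
      congr (_%:R).
      by apply: eq_card => y; rewrite in_setD1 andbC.
    rewrite /cells yT (negPf yq); case: eqVneq => // yp.
    by rewrite yp pT in yT.
  case: eqVneq => [->|xq].
    rewrite -/S (bigD1 p)//= cp; congr (_ + _).
    rewrite (eq_bigr (fun=> v4)) => [|y /andP[yS yp]].
      rewrite big_const iter_addr_0 -mulr_natl.
      congr (_ * _); rewrite /b (cardsD1 p S) pS natrD addrAC subrr add0r.
      congr (_%:R).
      by apply: eq_card => y; rewrite in_setD1 andbC.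
    rewrite /cells (negPf yp); case: eqVneq => [yq|_]; first by rewrite yq qS in yS.
    have /negPf-> : y \notin T by apply/negP => yT; exact: (disjST yS yT).
    by rewrite yS.
  have [xT|xT] := boolP (x \in T); first by rewrite treeT// big_set1.
  have [xS|xS] := boolP (x \in S); first by rewrite treeS// big_set1.
  rewrite big1// => y; rewrite inE => /bip.
  by rewrite (negPf xT) (negPf xS).
rewrite /nform; under eq_bigr do rewrite row.
rewrite sum_cellsM; ring.
Qed.

(** * Test vectors when the complement is a double star *)

Hypothesis treeE : (\sum_(x : G) #|nnbr x| + 2 = 2 * (#|S| + #|T|))%N.
Hypothesis treeT : forall x : G, x \in T -> x != q -> nnbr x = [set p].
Hypothesis treeS : forall x : G, x \in S -> x != p -> nnbr x = [set q].

Definition cells_norm (v1 v2 v3 v4 v5 : R) :=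
  v1 ^+ 2 + v2 ^+ 2 + a * v3 ^+ 2 + b * v4 ^+ 2 + i * v5 ^+ 2.

(** The adjacency form of [G] on a cell vector, by [qform_nform] and [nform_cells]. *)
Definition cells_form (v1 v2 v3 v4 v5 : R) :=
  (v1 + v2 + a * v3 + b * v4 + i * v5) ^+ 2 - cells_norm v1 v2 v3 v4 v5
  - 2 * (v1 * v2 + a * (v1 * v3) + b * (v2 * v4)).

(** The left-hand side of the last premise is half the target, as [n = a + b + i + 2] and [H] has
    [a + b + 1] edges. *)
Lemma cells_bound (v1 v2 v3 v4 v5 w1 w2 w3 w4 w5 : R) :
  v1 * w1 + v2 * w2 + a * (v3 * w3) + b * (v4 * w4) + i * (v5 * w5) = 0 ->
  0 < cells_norm v1 v2 v3 v4 v5 -> 0 < cells_norm w1 w2 w3 w4 w5 ->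
  a + b + i + 1 - (a + b + 1) / (a + b + i + 2) <=
    cells_form v1 v2 v3 v4 v5 / cells_norm v1 v2 v3 v4 v5 +
    cells_form w1 w2 w3 w4 w5 / cells_norm w1 w2 w3 w4 w5 ->
  #|G|%:R - 1 + avg_degree R G <= energy R G.
Proof.
move=> dot v0 w0 h.
have := @energy_ge_qform2 R G (cells v1 v2 v3 v4 v5) (cells w1 w2 w3 w4 w5).
rewrite !sum_cells_sqr sum_cellsM => /(_ v0 w0 dot); apply: le_trans.
rewrite !qform_nform !sum_cells !sum_cells_sqr !nform_cells//.
rewrite -/(cells_norm v1 v2 v3 v4 v5) -/(cells_norm w1 w2 w3 w4 w5).
rewrite -/(cells_form v1 v2 v3 v4 v5) -/(cells_form w1 w2 w3 w4 w5).
have n0 : 0 < #|G|%:R :> R by rewrite ltr0n.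
have nE : #|G|%:R = a + b + i + 2 :> R by rewrite /a /b /i; ring.
have E2E : E2 = 2 * (a + b + 1).
  have : (E2 + 2 = 2 * (#|S|%:R + #|T|%:R))%R.
    by rewrite /E2 -natrD -[2]/(2%:R) -natrD -natrM treeE.
  by rewrite /a /b; lra.
have dE : avg_degree R G = #|G|%:R - 1 - E2 / #|G|%:R.
  apply: (mulfI (lt0r_neq0 n0)); rewrite avg_degree_nnbr// -/E2; field.
  by rewrite lt0r_neq0.
rewrite dE E2E nE; move: h; rewrite -mulrA; lra.
Qed.

(** The first vector halves the weight of the two centres, which have low degree in [G]; the second
    one opposes [S] to [T] and has Rayleigh quotient at least [3 / 4]. *)
Lemma double_star_bound0 : 1 <= a -> 1 <= b -> 3 <= a + b -> a^-1 + b^-1 <= 3 / 2 -> i = 0 ->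
  #|G|%:R - 1 + avg_degree R G <= energy R G.
Proof.
move=> a1 b1 N3 c32 i0.
have a0 : a != 0 by lra.
have b0 : b != 0 by lra.
have ia : 0 < a^-1 by rewrite invr_gt0; lra.
have ib : 0 < b^-1 by rewrite invr_gt0; lra.
have nw : cells_norm (3 / 2) (- (3 / 2)) (- a^-1) b^-1 0 = 9 / 2 + (a^-1 + b^-1).
  by rewrite /cells_norm; field; rewrite a0 b0.
have nv : cells_norm 1 1 2 2 2 = 2 + 4 * (a + b) by rewrite /cells_norm i0; ring.
apply: (@cells_bound 1 1 2 2 2 (3 / 2) (- (3 / 2)) (- a^-1) b^-1 0).
- by field; rewrite a0 b0.
- by rewrite nv; lra.
- by rewrite nw; lra.
have -> : cells_form (3 / 2) (- (3 / 2)) (- a^-1) b^-1 0 = 6 - (a^-1 + b^-1).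
  by rewrite /cells_form nw; field; rewrite a0 b0.
have -> : cells_form 1 1 2 2 2 = 4 * (a + b) ^+ 2.
  by rewrite /cells_form nv i0; ring.
rewrite nv nw i0; move: (a^-1 + b^-1) c32 (addr_gt0 ia ib) => c c32 c0.
have : 3 / 4 <= (6 - c) / (9 / 2 + c) by rewrite ler_pdivlMr; lra.
move: (a + b) N3 => N N3.
have -> : 4 * N ^+ 2 / (2 + 4 * N) = N - 1 / 2 + 1 / 2 * (1 + 2 * N)^-1 by field; lra.
have -> : (N + 1) / (N + 0 + 2) = 1 - (N + 2)^-1 by field; lra.
have : (N + 2)^-1 <= 5^-1 by rewrite lef_pV2 ?posrE; lra.
have : 0 < (1 + 2 * N)^-1 by rewrite invr_gt0; lra.
lra.
Qed.

Lemma double_star_bound1 : 1 <= a -> 1 <= b ->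
  (a = 1 /\ b = 1) \/ (3 <= a + b /\ a^-1 + b^-1 <= 3 / 2) -> i = 1 ->
  #|G|%:R - 1 + avg_degree R G <= energy R G.
Proof.
move=> a1 b1 ab i1.
have a0 : a != 0 by lra.
have b0 : b != 0 by lra.
have ia : 0 < a^-1 by rewrite invr_gt0; lra.
have ib : 0 < b^-1 by rewrite invr_gt0; lra.
have nw : cells_norm (3 / 2) (- (3 / 2)) (- a^-1) b^-1 0 = 9 / 2 + (a^-1 + b^-1).
  by rewrite /cells_norm; field; rewrite a0 b0.
have nv : cells_norm 1 1 2 2 2 = 6 + 4 * (a + b) by rewrite /cells_norm i1; ring.
apply: (@cells_bound 1 1 2 2 2 (3 / 2) (- (3 / 2)) (- a^-1) b^-1 0).
- by field; rewrite a0 b0.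
- by rewrite nv; lra.
- by rewrite nw; lra.
have -> : cells_form (3 / 2) (- (3 / 2)) (- a^-1) b^-1 0 = 6 - (a^-1 + b^-1).
  by rewrite /cells_form nw; field; rewrite a0 b0.
have -> : cells_form 1 1 2 2 2 = 4 * (a + b) ^+ 2 + 8 * (a + b) + 8.
  by rewrite /cells_form nv i1; ring.
rewrite nv nw i1; case: ab => [[-> ->]|[N3]].
  (* For [a = b = 1] the sum of inverses is 2, beyond the bound [3 / 2], so the values are compared
     directly. *)
  rewrite invr1 [leLHS](_ : _ = 17 / 5); last by field.
  by rewrite [leRHS](_ : _ = 20 / 7 + 8 / 13); [lra | field].
move: (a^-1 + b^-1) (addr_gt0 ia ib) => c c0 c32.
have : 3 / 4 <= (6 - c) / (9 / 2 + c) by rewrite ler_pdivlMr; lra.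
move: (a + b) N3 => N N3.
have -> : (4 * N ^+ 2 + 8 * N + 8) / (6 + 4 * N) = N + 1 / 2 + 5 * (6 + 4 * N)^-1.
  by field; lra.
have -> : (N + 1) / (N + 1 + 2) = 1 - 2 * (N + 3)^-1 by field; lra.
have : (N + 3)^-1 <= 6^-1 by rewrite lef_pV2 ?posrE; lra.
have : 0 < (6 + 4 * N)^-1 by rewrite invr_gt0; lra.
have : (4 * (N + 3))^-1 <= (6 + 4 * N)^-1 by rewrite lef_pV2 ?posrE; lra.
rewrite invfM; lra.
Qed.

(** In [G], [p] is a pendant vertex attached to the one vertex isolated in [H], and all other
    vertices form a clique with it. The first vector is the indicator of the clique; [y] makes the
    second orthogonal to it. *)
Lemma pendant_bound : 2 <= a -> b = 0 -> i = 1 ->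
  #|G|%:R - 1 + avg_degree R G <= energy R G.
Proof.
move=> a2 b0 i1; pose y := (a + 1)^-1.
have y0 : 0 < y by rewrite invr_gt0; lra.
have y3 : y <= 3^-1 by rewrite lef_pV2 ?posrE; lra.
have ya : a + 1 != 0 by lra.
have nw : cells_norm (3 / 2) (- y) (- y) 0 1 = 13 / 4 + y.
  by rewrite /cells_norm b0 i1 /y; field.
have nv : cells_norm 0 1 1 0 1 = a + 2 by rewrite /cells_norm b0 i1; ring.
apply: (@cells_bound 0 1 1 0 1 (3 / 2) (- y) (- y) 0 1).
- by rewrite b0 i1 /y; field.
- by rewrite nv; lra.
- by rewrite nw; lra.
have -> : cells_form (3 / 2) (- y) (- y) 0 1 = 2 - y.
  by rewrite /cells_form nw b0 i1 /y; field.
have -> : cells_form 0 1 1 0 1 = (a + 1) * (a + 2).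
  by rewrite /cells_form nv b0 i1; ring.
rewrite nv nw b0 i1 mulfK; last by lra.
have : 2 / 5 <= (2 - y) / (13 / 4 + y) by rewrite ler_pdivlMr; lra.
have -> : (a + 0 + 1) / (a + 0 + 1 + 2) = 1 - 2 * (a + 3)^-1 by field; lra.
have : (a + 3)^-1 <= 5^-1 by rewrite lef_pV2 ?posrE; lra.
lra.
Qed.

(** [H] is a path on three vertices with two isolated vertices. The vectors are orthogonal integer
    approximations of the eigenvectors for the two positive eigenvalues of [G]. *)
Lemma co_path_bound : a = 1 -> b = 0 -> i = 2 ->
  #|G|%:R - 1 + avg_degree R G <= energy R G.
Proof.
move=> a1 b0 i2.
have nw : cells_norm 10 (- 5) (- 5) 0 1 = 152 by rewrite /cells_norm a1 b0 i2; ring.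
have nv : cells_norm 3 4 4 0 5 = 91 by rewrite /cells_norm a1 b0 i2; ring.
apply: (@cells_bound 3 4 4 0 5 10 (- 5) (- 5) 0 1).
- by rewrite a1 b0 i2; ring.
- by rewrite nv.
- by rewrite nw.
have -> : cells_form 10 (- 5) (- 5) 0 1 = 52.
  by rewrite /cells_form nw a1 b0 i2; ring.
have -> : cells_form 3 4 4 0 5 = 302.
  by rewrite /cells_form nv a1 b0 i2; ring.
by rewrite nv nw a1 b0 i2 [leLHS](_ : _ = 18 / 5); [lra | field].
Qed.

End Bipartite.

(** * The energy bounds *)

Lemma twins_singular (R : realType) (G : sgraph) (x y : G) : x != y ->
  (forall z, adjacent x z = adjacent y z) -> ~~ nonsingular R G.
Proof.
move=> xy tw; rewrite /nonsingular unitmxE unitfE negbK; apply/eqP.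
apply: (@determinant_alternate _ _ _ (enum_rank x) (enum_rank y)).
  by rewrite (inj_eq enum_rank_inj).
by move=> j; rewrite !mxE !enum_rankK tw.
Qed.

Lemma isolated_singular (R : realType) (G : sgraph) (x : G) :
  (forall z, adjacent x z = false) -> ~~ nonsingular R G.
Proof.
move=> iso; rewrite /nonsingular unitmxE unitfE negbK; apply/eqP.
rewrite (expand_det_row _ (enum_rank x)) big1// => j _.
by rewrite mxE enum_rankK iso mul0r.
Qed.

Lemma avg_degree_complete (R : realType) (G : sgraph) : (0 < #|G|)%N ->
  (avg_degree R G == #|G|%:R - 1) = (\sum_(x : G) #|nnbr x| == 0)%N.
Proof.
move=> n0; have n0R : #|G|%:R != 0 :> R by rewrite pnatr_eq0 -lt0n.
rewrite -(pnatr_eq0 R); have := @avg_degree_nnbr R G n0.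
move=> e; apply/eqP/eqP => h; first by move: e; rewrite h; lra.
by apply: (mulfI n0R); rewrite e h; ring.
Qed.

Lemma inv_add_le (R : realType) (a b : nat) : (3 <= a + b)%N -> (0 < a)%N -> (0 < b)%N ->
  (a%:R)^-1 + (b%:R)^-1 <= 3 / 2 :> R.
Proof.
move=> ab a0 b0; have inv1 k : (0 < k)%N -> (k%:R)^-1 <= 1 :> R.
  by move=> k0; rewrite invf_le1 ?ltr0n// ler1n.
have inv2 k : (1 < k)%N -> (k%:R)^-1 <= 2^-1 :> R.
  by move=> k0; rewrite lef_pV2 ?posrE ?ltr0n// ?(ler_nat R 2)//; lia.
have [a2|b2] : (1 < a)%N \/ (1 < b)%N by lia.
  by have := inv1 b b0; have := inv2 a a2; lra.
by have := inv1 a a0; have := inv2 b b2; lra.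
Qed.

(** An edgeless [H] needs only the all-ones vector, and an [H] with more edges than the double star
    falls under [uniform_bound]. Double stars are sorted by their leaf counts [b <= a] and the
    number [i] of isolated vertices. *)
Lemma few_positive_bound (R : realType) (G : sgraph) : (5 <= #|G|)%N ->
  nonsingular R G -> few_positive R G ->
  #|G|%:R - 1 + avg_degree R G <= energy R G.
Proof.
move=> n5 ns few; have n0 : (0 < #|G|)%N by lia.
have n0R : 0 < #|G|%:R :> R by rewrite ltr0n.
have [/eqP sum0|sumN0] := boolP (\sum_(x : G) #|nnbr x| == 0)%N.
  have dE : avg_degree R G = #|G|%:R - 1.
    by apply/eqP; rewrite avg_degree_complete// sum0.
  have := @energy_ge_qform R G (fun=> 1).
  rewrite sum_sqr1 => /(_ n0R); apply: le_trans.
  by rewrite qform1// mulrAC divff ?lt0r_neq0// mul1r dE; lra.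
have /card_gt0P[z0 _] := n0.
case: (@arg_maxnP G z0 xpredT (fun x => #|nnbr x|) isT) => p _ maxp.
have p0 : (0 < #|nnbr p|)%N.
  rewrite lt0n; apply: contra sumN0 => /eqP p0; rewrite sum_nat_eq0.
  by apply/forallP => x; rewrite /= -leqn0 -p0; exact: maxp.
have /card_gt0P[q0 q0P] := p0.
case: (@arg_maxnP G q0 (fun x => x \in nnbr p) (fun x => #|nnbr x|) q0P) => q qP maxq.
have pq : nadj p q by rewrite inE in qP.
have maxp' (x : G) : (#|nnbr x| <= #|nnbr p|)%N by exact: maxp.
have maxq' (x : G) : nadj p x -> (#|nnbr x| <= #|nnbr q|)%N.
  by move=> px; apply: maxq; rewrite inE.
have disj := @disjoint_ST R G few p q pq.
have bip (x y : G) : nadj x y ->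
    (x \in nnbr q) && (y \in nnbr p) || (x \in nnbr p) && (y \in nnbr q).
  move=> xy; have [e1 [e2 e3]] := nadj_bipartite few maxp' pq maxq' xy.
  by rewrite -e1 -e2 e3; case: (x \in nnbr p).
have ST := card_ST_le disj.
have uniform := @uniform_bound R G p q pq disj bip.
have [h|[treeE treeT treeS]] := tree_dichotomy pq disj bip.
  (* From [s + t <= n] and [2 (s + t) <= E2] follows [E2 (s + t) <= n E2 <= 2 n (E2 - (s + t))]. *)
  apply: uniform; rewrite -!natrD.
  have hR : 2 * (#|nnbr q| + #|nnbr p|)%:R <= (\sum_(x : G) #|nnbr x|)%:R :> R.
    by rewrite -[2]/(2%:R) -natrM ler_nat.
  have STR : (#|nnbr q| + #|nnbr p|)%:R <= #|G|%:R :> R by rewrite ler_nat.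
  have E0 : 0 <= (\sum_(x : G) #|nnbr x|)%:R :> R by rewrite ler0n.
  have := mulr_ge0 E0 (_ : 0 <= #|G|%:R - (#|nnbr q| + #|nnbr p|)%:R).
  rewrite subr_ge0 => /(_ STR).
  have := mulr_ge0 (ltW n0R) (_ : 0 <= (\sum_(x : G) #|nnbr x|)%:R -
    2 * (#|nnbr q| + #|nnbr p|)%:R).
  rewrite subr_ge0 => /(_ hR); lra.
have qp := maxp' q.
have s0 : (0 < #|nnbr q|)%N by apply/card_gt0P; exists p; rewrite inE nadjC.
pose a := (#|nnbr p| - 1)%N; pose b := (#|nnbr q| - 1)%N.
pose i := (#|G| - #|nnbr p| - #|nnbr q|)%N.
have aE : #|nnbr p|%:R - 1 = a%:R :> R by rewrite natrB.
have bE : #|nnbr q|%:R - 1 = b%:R :> R by rewrite natrB.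
have iE : #|G|%:R - #|nnbr p|%:R - #|nnbr q|%:R = i%:R :> R.
  by rewrite !natrB//; lia.
(* For a double star the hypothesis of [uniform_bound] reduces to [2 <= (i - 1) (a + b)]. *)
have tree_uniform : (1 < a + b)%N || ((a + b == 1) && (2 < i))%N -> (1 < i)%N ->
    #|G|%:R - 1 + avg_degree R G <= energy R G.
  move=> ab i2; apply: uniform; rewrite -!natrD.
  have -> : (\sum_(x : G) #|nnbr x|)%:R = 2 * (#|nnbr q| + #|nnbr p|)%:R - 2 :> R.
    rewrite -[2]/(2%:R) -natrM -natrB; first by congr (_%:R); lia.
    lia.
  have -> : #|G|%:R = (#|nnbr q| + #|nnbr p|)%:R + i%:R :> R.
    by rewrite -natrD; congr (_%:R); lia.
  have -> : (#|nnbr q| + #|nnbr p|)%N = (a + b + 2)%N by lia.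
  have i2R : 2 <= i%:R :> R by rewrite (ler_nat R 2).
  rewrite natrD; case/orP: ab => [ab|/andP[/eqP-> i3]].
    have : 2 <= (a + b)%:R :> R by rewrite (ler_nat R 2).
    move=> N2; have := mulr_ge0 (_ : 0 <= i%:R - 2 :> R) (_ : 0 <= (a + b)%:R - 2 :> R).
    by rewrite !subr_ge0 => /(_ i2R N2); lra.
  by have : 3 <= i%:R :> R by [rewrite (ler_nat R 3)]; lra.
have [b0|b1] := posnP b.
- have b0R : #|nnbr q|%:R - 1 = 0 :> R by rewrite bE b0.
  have q1 : nnbr q = [set p].
    apply/esym/eqP; rewrite eqEcard cards1 sub1set inE nadjC pq/=; lia.
  have [a0|a1] := posnP a.
    (* Here [p] and [q] have only each other as [H]-neighbour, so they are twins in [G] and give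
       equal rows. *)
    have p1 : nnbr p = [set q].
      apply/esym/eqP; rewrite eqEcard cards1 sub1set inE pq/=; lia.
    have pNq : p != q by case/andP: pq.
    suff : ~~ nonsingular R G by rewrite ns.
    apply: (twins_singular R pNq) => z.
    case/andP: (pq) => _ npq.
    have [->|zp] := eqVneq z p; first by rewrite adjacent_irrefl adjacent_sym (negPf npq).
    have [->|zq] := eqVneq z q; first by rewrite adjacent_irrefl (negPf npq).
    rewrite !adjacentE 1?eq_sym//.
    have := in_set1 z q; rewrite -p1 inE => ->; rewrite (negPf zq).
    by have := in_set1 z p; rewrite -q1 inE => ->; rewrite (negPf zp).
  have [i0|i1] := posnP i.
    (* Now [p] is [H]-adjacent to every other vertex, hence isolated in [G]. *)
    suff : ~~ nonsingular R G by rewrite ns.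
    apply: (@isolated_singular R G p) => z; apply/negP => pz.
    have := card_nnbr_degree p.
    have : (0 < degree p)%N by apply/card_gt0P; exists z; rewrite inE.
    lia.
  have [i1'|i2] := eqVneq i 1%N.
    apply: (pendant_bound pq disj bip treeE treeT treeS) => //; last by rewrite iE i1'.
    by rewrite aE (ler_nat R 2); lia.
  have [a1'|a2] := eqVneq a 1%N; last by apply: tree_uniform; lia.
  have [i2'|i3] := eqVneq i 2%N; last by apply: tree_uniform; lia.
  apply: (co_path_bound pq disj bip treeE treeT treeS) => //.
    by rewrite aE a1'.
  by rewrite iE i2'.
have a1 : (0 < a)%N by lia.
have a1R : 1 <= #|nnbr p|%:R - 1 :> R by rewrite aE (ler_nat R 1).
have b1R : 1 <= #|nnbr q|%:R - 1 :> R by rewrite bE (ler_nat R 1).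
have [i0|i0] := eqVneq i 0%N.
  apply: (double_star_bound0 pq disj bip treeE treeT treeS) => //.
  - by rewrite aE bE -natrD (ler_nat R 3); lia.
  - by rewrite aE bE inv_add_le//; lia.
  - by rewrite iE i0.
have [i1|i1] := eqVneq i 1%N; last by apply: tree_uniform; lia.
apply: (double_star_bound1 pq disj bip treeE treeT treeS) => //; last by rewrite iE i1.
rewrite aE bE; have [ab|ab] := ltnP (a + b) 3.
  have [-> ->] : a = 1%N /\ b = 1%N by lia.
  by left.
right; split; first by rewrite -natrD (ler_nat R 3).
exact: inv_add_le.
Qed.

Lemma energy_ge_order_avg_degree (R : realType) (G : sgraph) : (5 <= #|G|)%N ->
  nonsingular R G -> #|G|%:R - 1 + avg_degree R G <= energy R G.
Proof.
move=> n5 ns; have n0 : (0 < #|G|)%N by lia.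
by case: (energy_or_few_positive n0 ns) => // few; exact: few_positive_bound.
Qed.

(** * Degree bounds and the equality cases *)

Lemma degree_le (G : sgraph) (x : G) : (degree x <= #|G| - 1)%N.
Proof. by have := card_nnbr_degree x; lia. Qed.

Lemma max_degree_le (G : sgraph) : (max_degree G <= #|G| - 1)%N.
Proof. by apply/bigmax_leqP => x _; exact: degree_le. Qed.

Lemma bigminn_le (T : eqType) (m : nat) (F : T -> nat) (s : seq T) (x : T) :
  x \in s -> (\big[minn/m]_(y <- s) F y <= F x)%N.
Proof.
elim: s => // y s IHs; rewrite inE big_cons => /orP[/eqP->|xs]; first exact: geq_minl.
by apply: leq_trans (geq_minr _ _) (IHs xs).
Qed.

Lemma min_degree_le (G : sgraph) (x : G) : (min_degree G <= degree x)%N.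
Proof. by apply: bigminn_le; exact: mem_index_enum. Qed.

Lemma degree_le_max (G : sgraph) (x : G) : (degree x <= max_degree G)%N.
Proof. exact: leq_bigmax. Qed.

Lemma min_degree_le_avg (R : realType) (G : sgraph) : (0 < #|G|)%N ->
  (min_degree G)%:R <= avg_degree R G.
Proof.
move=> n0; have n0R : 0 < #|G|%:R :> R by rewrite ltr0n.
rewrite -(ler_pM2l n0R) avg_degreeE// card_edges2 -natrM ler_nat.
by rewrite -sum_nat_const; apply: leq_sum => x _; exact: min_degree_le.
Qed.

(** A mean equal to the minimum forces all terms to be equal. *)
Lemma degree_eq_min_degree (R : realType) (G : sgraph) (x : G) : (0 < #|G|)%N ->
  (min_degree G)%:R = avg_degree R G -> degree x = min_degree G.
Proof.
move=> n0 minE.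
have sumE : (\sum_(y : G) min_degree G = \sum_(y : G) degree y)%N.
  apply/eqP; rewrite sum_nat_const -card_edges2 -(eqr_nat R) natrM minE.
  by rewrite avg_degreeE.
have := @leqif_sum _ predT _ (fun=> min_degree G) (@degree G)
  (fun y _ => leqif_eq (min_degree_le y)).
by case=> _; rewrite sumE eqxx => /esym/forallP/(_ x)/eqP.
Qed.

Lemma complete_of_avg_degree (R : realType) (G : sgraph) : (0 < #|G|)%N ->
  avg_degree R G = #|G|%:R - 1 -> isomorphic G (complete #|G|).
Proof.
move=> n0 /eqP; rewrite avg_degree_complete// sum_nat_eq0 => /forallP all0.
exists (enum_rank : G -> complete #|G|); first exact: enum_rank_bij.
move=> x y; rewrite /= (inj_eq enum_rank_inj).
have [->|xy] := eqVneq x y; first by rewrite adjacent_irrefl.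
rewrite adjacentE//; apply/esym/negP => nxy.
have := all0 x; rewrite /= cards_eq0 => /eqP/setP/(_ y).
by rewrite !inE nxy.
Qed.

Theorem mainTheorem3 (R : realType) (G : sgraph)
    (order_ge5 : (5 <= #|G|)%N) (G_nonsing : nonsingular R G) :
  [/\ energy R G >= #|G|%:R - 1 + avg_degree R G,
      energy R G >= (max_degree G)%:R + (min_degree G)%:R
    & energy R G >= 2 * Num.sqrt (avg_degree R G * (#|G|%:R - 1))] /\
  (energy R G = (max_degree G)%:R + (min_degree G)%:R \/
   energy R G = 2 * Num.sqrt (avg_degree R G * (#|G|%:R - 1)) ->
   isomorphic G (complete #|G|)).
Proof.
have n0 : (0 < #|G|)%N by lia.
have E1 := energy_ge_order_avg_degree order_ge5 G_nonsing.
have minE := min_degree_le_avg R n0.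
have maxE : (max_degree G)%:R <= #|G|%:R - 1 :> R.
  by rewrite -(@natrB R _ 1)// ler_nat max_degree_le.
have n1 : 0 <= #|G|%:R - 1 :> R by rewrite subr_ge0 ler1n.
have d0 : 0 <= avg_degree R G by rewrite /avg_degree divr_ge0.
rewrite sqrtrM//; set u := Num.sqrt (avg_degree R G); set v := Num.sqrt _.
have uE : u ^+ 2 = avg_degree R G by rewrite sqr_sqrtr.
have vE : v ^+ 2 = #|G|%:R - 1 by rewrite sqr_sqrtr.
(* Third inequality: [d + (n - 1) - 2 u v] is this square. *)
have uv := sqr_ge0 (u - v).
split; first by split=> //; [lra | nra].
move=> Eeq; apply: (@complete_of_avg_degree R) => //.
case: Eeq => Eeq.
  (* Equality squeezes both degree estimates: [G] is regular of degree [d], and its maximum degree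
     is [n - 1]. *)
  have minEq : (min_degree G)%:R = avg_degree R G by apply/eqP; rewrite eq_le; apply/andP; split; lra.
  have maxEq : (max_degree G)%:R = #|G|%:R - 1 :> R by apply/eqP; rewrite eq_le; apply/andP; split; lra.
  have deg := degree_eq_min_degree _ n0 minEq.
  have : (max_degree G <= min_degree G)%N.
    by apply/bigmax_leqP => x _; rewrite deg.
  have /card_gt0P[x _] := n0.
  have : (min_degree G <= max_degree G)%N by rewrite -(deg x) degree_le_max.
  by rewrite -!(ler_nat R) minEq maxEq => ? ?; apply/eqP; rewrite eq_le; apply/andP.
(* Equality together with the first bound leaves no room for the square, so [d = n - 1]. *)
have /eqP : (u - v) ^+ 2 = 0 by apply/eqP; rewrite eq_le; apply/andP; split; nra.
by rewrite sqrf_eq0 subr_eq0 => /eqP uv0; rewrite -uE uv0 vE.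
Qed.
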